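(* Let $\mathbb{H}$ be a complex Hilbert space, let $T\in B(\mathbb{H})$, and put $P=T^*T+TT^*$. Then $$w^4(T)\leq \frac1{16}\min_{t\in[0,1]}\left(w(\widetilde{T}_t^{\,2})+\|T\|\,\|\widetilde{T}_t\|\right)^2+\frac18 w(T^2P+PT^2)+\frac1{16}\|P\|^2.$$ In particular, $$w^4(T)\leq \frac1{16}\left(w(\widetilde{T}^{\,2})+\|T\|\,\|\widetilde{T}\|\right)^2+\frac18 w(T^2P+PT^2)+\frac1{16}\|P\|^2.$$
   Context: $B(\mathbb{H})$ is the algebra of bounded linear operators on $\mathbb{H}$ and $\|\cdot\|$ the operator norm. The numerical radius is $w(T)=\sup\{|\langle Tx,x\rangle|: x\in\mathbb{H},\ \|x\|=1\}$, and $w^4(T)=(w(T))^4$. For $T\in B(\mathbb{H})$, $|T|=(T^*T)^{1/2}$ and $T=U|T|$ is the polar decomposition, with $U$ the partial isometry satisfying $\ker U=\ker T$. For $t\in[0,1]$ the $t$-Aluthge transform of $T$ is $\widetilde{T}_t=|T|^{t}U|T|^{1-t}$, with the convention $|T|^0:=U^*U$; $\widetilde{T}=\widetilde{T}_{1/2}=|T|^{1/2}U|T|^{1/2}$ is the Aluthge transform. $\widetilde{T}_t^{\,2}$ denotes the square $(\widetilde{T}_t)^2$ of the operator $\widetilde{T}_t$, and $\widetilde{T}^{\,2}=(\widetilde{T})^2$. *)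

(* Defs.v *)
From HB Require Import structures.
From mathcomp Require Import all_boot all_order all_algebra.
From mathcomp Require Import complex.
From mathcomp Require Import all_classical all_reals all_analysis.

Set Implicit Arguments.
Unset Strict Implicit.
Unset Printing Implicit Defensive.

Import Order.TTheory GRing.Theory Num.Theory.
Import numFieldNormedType.Exports.

Local Open Scope classical_set_scope.
Local Open Scope ring_scope.
Local Open Scope complex_scope.

(* [inner] is linear in its first argument and conjugate-linear in the second.
   The zero space is allowed, and no separability is assumed. *)
Record hilbertType (R : realType) := HilbertType {
  hilbert_sort :> completeNormedModType R[i] ;
  inner : {dot hilbert_sort for Num.conj} ;
  inner_norm : forall x : hilbert_sort, `|x| ^+ 2 = inner x x
}.

Arguments inner {R h} : rename.

Section Operators.
Variables (R : realType) (H : hilbertType R).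
Implicit Types (x y : H) (A B S T U : H -> H) (t : R).

(* Norms take their values in [R[i]] (on the nonnegative real axis). *)
Definition realnorm (V : normedModType R[i]) (v : V) : R := complex.Re `|v|.

Definition bounded_operator T : Prop :=
  linear T /\ exists M : R, forall x, `|T x| <= M%:C * `|x|.

(* Real-valued; equal to 0 on the zero space, since [sup set0 = 0]. *)
Definition opnorm T : R := sup [set realnorm (T x) | x in [set x | `|x| = 1]].

Definition numradius T : R :=
  sup [set complex.Re `|inner (T x) x| | x in [set x | `|x| = 1]].

Definition is_adjoint T S : Prop :=
  forall x y, inner (T x) y = inner x (S y).

Definition adjoint T : H -> H := xget (fun=> 0) [set S | is_adjoint T S].

Definition poly_op (p : {poly R}) A : H -> H :=
  fun x => \sum_(i < size p) (p`_i)%:C *: iter i A x.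

(* [B = f(A)] in the continuous functional calculus of a positive operator [A],
   whose spectrum lies in [[0, opnorm A]]: [B] is the operator-norm limit of
   [p(A)] for real polynomials [p] converging to [f] uniformly on that interval.
   The estimate on [p(A) - B] is spelled out pointwise because [opnorm] is only
   meaningful on bounded operators. *)
Definition is_cfc (f : R -> R) A B : Prop :=
  forall e : R, 0 < e -> exists p : {poly R},
    (forall s : R, 0 <= s <= opnorm A -> `|p.[s] - f s| <= e) /\
    (forall x, `|poly_op p A x - B x| <= e%:C * `|x|).

(* Meant for [A] positive and [0 < t]. *)
Definition oppow A t : H -> H :=
  xget (fun=> 0) [set B | is_cfc (fun s => s `^ t) A B].

Definition absop T : H -> H := oppow (adjoint T \o T) 2^-1.

Definition partial_isometry U : Prop :=
  bounded_operator U /\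
  forall x, (forall y, U y = 0 -> inner x y = 0) -> `|U x| = `|x|.

Definition is_polar T U : Prop :=
  [/\ partial_isometry U, T = U \o absop T & forall x, U x = 0 <-> T x = 0].

Definition polar T : H -> H := xget (fun=> 0) [set U | is_polar T U].

Definition abspow T t : H -> H :=
  if t == 0 then adjoint (polar T) \o polar T else oppow (absop T) t.

Definition aluthge_t t T : H -> H :=
  abspow T t \o polar T \o abspow T (1 - t).

Definition aluthge T : H -> H := aluthge_t 2^-1 T.

End Operators.

Definition is_minimum (R : realType) (A : set R) (m : R) : Prop :=
  A m /\ lbound A m.

(* Main.v *)
(* For a unit [x] and a phase [k], let [Q = kT + (kT)^*] and [W = (kT)^2 + (kT)^*^2], so
   that [Q^2 = W + P].  Then
     [16 Re(k <Tx, x>)^4 = <Qx, x>^4 <= |Q^2 x|^2 = |Wx|^2 + 2 Re<Wx, Px> + |Px|^2],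
   where [2 Re<Wx, Px> = 2 Re(k^2 <(T^2 P + P T^2)x, x>)], and the self-adjoint operator
   [W] has norm at most [2 w(T^2)].  It remains to see that
   [2 w(T^2) <= w(S^2) + ||T|| ||S||] for [S = |T|^t U |T|^(1-t)].  This is an instance of
   [2 w(AB) <= w(BA) + ||A|| ||B||], with [A = U |T|^(1-t) S] and [B = |T|^t].

   The map [t |-> S] is strongly continuous on [[0, 1]], endpoints included: away from the
   kernel of [T] it is enough to look at the range of [|T|], where [s^t s] is Lipschitz in
   [t].  A supremum of continuous functions is lower semicontinuous, so [w(S^2)] and
   [||S||] are, and the minimum over [t] is attained.

   The functional calculus rests on [||p(A)|| <= sup |p|] for positive [A] and on the
   uniform approximation of [s^t] by Bernstein polynomials. *)
Require Import Defs.
From HB Require Import structures.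
From mathcomp Require Import all_boot all_order all_algebra.
From mathcomp Require Import complex.
From mathcomp Require Import all_classical all_reals all_analysis.
From mathcomp Require Import ring lra.

Set Implicit Arguments.
Unset Strict Implicit.
Unset Printing Implicit Defensive.

Import Order.TTheory GRing.Theory Num.Theory.
Import numFieldNormedType.Exports.

Local Open Scope classical_set_scope.
Local Open Scope ring_scope.

(** * The real part of the inner product *)

Section HilbertSpace.
Local Open Scope complex_scope.
Variables (R : realType) (H : hilbertType R).
Implicit Types (x y z : H) (a b c e : R).

Local Notation nr := (@realnorm R H).

(** Only real parts of inner products are compared. Phases are carried as explicit unimodular
    scalars, since |<Tx, x>| is the largest value of Re(k <Tx, x>); imaginary parts are recovered by
    testing with ['i] times a vector as well.

    [adjoint], [oppow] and [polar] are choices with a default value, so each needs an existence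
    proof, after which only its defining property is available. Existence always comes from a Cauchy
    sequence: a minimising sequence behind the adjoint, polynomials in the operator behind its
    powers and behind the polar factor.

    The obstacle in t lies at the endpoints. As t tends to 0, s^t tends to 1 for each s > 0, but not
    uniformly near s = 0, so |T|^t need not tend to |T|^0 in norm. This is why continuity is only
    strong. The convention |T|^0 = U^* U fits it: U^* U is 1 - K, with K the projection onto the
    kernel of T, obtained as the strong limit of (1 - c |T|)^n. *)

Definition rip x y : R := complex.Re (inner x y).

Lemma normE x : `|x| = (nr x)%:C.
Proof. by rewrite /realnorm RRe_real// normr_real. Qed.

Lemma nr_ge0 x : 0 <= nr x.
Proof. by rewrite -ler0c -normE. Qed.

Lemma norm_leE a x y : (`|x| <= a%:C * `|y|) = (nr x <= a * nr y).
Proof. by rewrite !normE -rmorphM lecR. Qed.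

Lemma nr0 : nr 0 = 0.
Proof. by rewrite /realnorm normr0. Qed.

Lemma nr_eq0 x : nr x = 0 -> x = 0.
Proof. by move=> x0; apply/normr0_eq0; rewrite normE x0. Qed.

Lemma nr_gt0 x : x != 0 -> 0 < nr x.
Proof.
by rewrite lt0r nr_ge0 andbT; apply: contraNneq => /nr_eq0 ->.
Qed.

Lemma nrN x : nr (- x) = nr x.
Proof. by rewrite /realnorm normrN. Qed.

Lemma nrC x y : nr (x - y) = nr (y - x).
Proof. by rewrite -nrN opprB. Qed.

Lemma nrD x y : nr (x + y) <= nr x + nr y.
Proof. by rewrite -lecR rmorphD /= -!normE ler_normD. Qed.

Lemma nrB x y z : nr (x - y) <= nr (x - z) + nr (z - y).
Proof. by apply: le_trans (nrD _ _); rewrite subrKA. Qed.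

Lemma nrZ (k : R[i]) x : nr (k *: x) = complex.Re `|k| * nr x.
Proof.
apply: (@complexI R).
by rewrite -normE normrZ rmorphM/= RRe_real ?normr_real// normE.
Qed.

Lemma nrZr a x : nr (a%:C *: x) = `|a| * nr x.
Proof. by rewrite nrZ normc_def /= expr0n /= addr0 sqrtr_sqr. Qed.

Lemma nr_le x y : nr x <= nr y + nr (x - y).
Proof. by rewrite -{1}(subrK y x) addrC nrD. Qed.

Lemma ripDl x y z : rip (x + y) z = rip x z + rip y z.
Proof. by rewrite /rip linearDl raddfD. Qed.

Lemma innerC x y : inner x y = (inner y x)^*%C.
Proof. by rewrite hermC expr0 mul1r. Qed.

Lemma ripC x y : rip x y = rip y x.
Proof. by rewrite /rip innerC; case: (inner y x). Qed.

Lemma ripDr x y z : rip x (y + z) = rip x y + rip x z.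
Proof. by rewrite ripC ripDl !(ripC x). Qed.

Lemma ripNl x y : rip (- x) y = - rip x y.
Proof. by rewrite /rip linearNl raddfN. Qed.

Lemma ripNr x y : rip x (- y) = - rip x y.
Proof. by rewrite ripC ripNl ripC. Qed.

Lemma ripBl x y z : rip (x - y) z = rip x z - rip y z.
Proof. by rewrite ripDl ripNl. Qed.

Lemma ripBr x y z : rip x (y - z) = rip x y - rip x z.
Proof. by rewrite ripDr ripNr. Qed.

Lemma rip0l x : rip 0 x = 0.
Proof. by rewrite -(subrr x) ripBl subrr. Qed.

Lemma rip0r x : rip x 0 = 0.
Proof. by rewrite ripC rip0l. Qed.

Lemma innerZl (k : R[i]) x y : inner (k *: x) y = k * inner x y.
Proof. by rewrite linearZl_LR. Qed.

Lemma innerZr (k : R[i]) x y : inner x (k *: y) = k^*%C * inner x y.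
Proof. by rewrite innerC innerZl rmorphM/= -innerC. Qed.

Lemma ripZl a x y : rip (a%:C *: x) y = a * rip x y.
Proof. by rewrite /rip innerZl; case: (inner x y) => u v /=; rewrite mul0r subr0. Qed.

Lemma ripZr a x y : rip x (a%:C *: y) = a * rip x y.
Proof. by rewrite ripC ripZl ripC. Qed.

Lemma ripxx x : rip x x = nr x ^+ 2.
Proof. by rewrite /rip -inner_norm normE -rmorphXn. Qed.

Lemma rip_i x y : complex.Im (inner x y) = rip x ('i *: y).
Proof. by rewrite /rip innerZr; case: (inner x y) => u v /=; ring. Qed.

Lemma rip_eq x y : (forall z, rip x z = rip y z) -> x = y.
Proof.
move=> xy; apply/subr0_eq/nr_eq0/eqP; rewrite -sqrf_eq0 -ripxx.
by rewrite ripBl xy subrr.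
Qed.

Lemma nr_sqrD x y : nr (x + y) ^+ 2 = nr x ^+ 2 + 2 * rip x y + nr y ^+ 2.
Proof. by rewrite -!ripxx !ripDl !ripDr (ripC y x); ring. Qed.

Lemma nr_sqrB x y : nr (x - y) ^+ 2 = nr x ^+ 2 - 2 * rip x y + nr y ^+ 2.
Proof. by rewrite nr_sqrD nrN ripNr; ring. Qed.

Lemma rip_le x y : rip x y <= nr x * nr y.
Proof.
have [->|x0] := eqVneq x 0; first by rewrite rip0l nr0 mul0r.
have [->|y0] := eqVneq y 0; first by rewrite rip0r nr0 mulr0.
have nx := nr_gt0 x0; have ny := nr_gt0 y0.
have := sqr_ge0 (nr ((nr y)%:C *: x - (nr x)%:C *: y)).
rewrite nr_sqrB !nrZr ripZl ripZr !ger0_norm ?nr_ge0//.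
have -> : (nr y * nr x) ^+ 2 - 2 * (nr y * (nr x * rip x y)) + (nr x * nr y) ^+ 2
  = 2 * (nr y * nr x) * (nr x * nr y - rip x y) by ring.
by rewrite pmulr_rge0 ?subr_ge0// !mulr_gt0.
Qed.

Lemma rip_norm_le x y : `|rip x y| <= nr x * nr y.
Proof. by rewrite ler_norml rip_le andbT lerNl -ripNl -(nrN x) rip_le. Qed.

(** The phase is the conjugate of <x, y> divided by its modulus, or 1 if <x, y> = 0. With
    [rip_le_norm] it turns the modulus in [numradius] into a supremum of real parts over phases. *)
Lemma Re_norm_inner x y : exists u : R[i],
  complex.Re `|u| = 1 /\ complex.Re `|inner x y| = rip (u *: x) y.
Proof.
have [i0|i0] := eqVneq (inner x y) 0.
  by exists 1; rewrite normr1 /rip innerZl i0 mulr0 normr0.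
exists ((inner x y)^*%C / `|inner x y|); split.
  by rewrite normrM normfV normr_id normcJ divff ?normr_eq0.
rewrite /rip innerZl; congr complex.Re.
rewrite mulrAC [_^*%C * _]mulrC -sqr_normc expr2 mulfK//.
by rewrite normr_eq0.
Qed.

Lemma rip_le_norm x y (u : R[i]) : complex.Re `|u| = 1 ->
  rip (u *: x) y <= complex.Re `|inner x y|.
Proof.
move=> u1; rewrite /rip innerZl; apply: (@le_trans _ _ `|complex.Re (u * inner x y)|).
  exact: ler_norm.
rewrite -lecR (le_trans (normc_ge_Re _))// normrM.
have -> : `|u| = 1 by rewrite -[LHS]RRe_real ?normr_real// u1.
by rewrite mul1r RRe_real ?normr_real.
Qed.

End HilbertSpace.

(** Closes every limiting argument. [K] collects the constants of the error terms and may vanish, as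
    when it is the norm of a vector; hence the division by [|K| + 1] in the proof. *)
Lemma le_eps (R : realType) (K x y : R) :
  (forall e, 0 < e -> x <= y + K * e) -> x <= y.
Proof.
move=> xy; apply/ler_addgt0Pr => e e0.
have K1 : 0 < `|K| + 1 by rewrite ltr_wpDl.
apply: le_trans (xy (e / (`|K| + 1)) _) _; first exact: divr_gt0.
rewrite lerD2l mulrCA ler_piMr ?(ltW e0)// ler_pdivrMr// mul1r.
by rewrite (le_trans (ler_norm _))// lerDl.
Qed.

Lemma inv_natS_le (R : realType) (e : R) : 0 < e ->
  exists N, forall n, (N <= n)%N -> n.+1%:R^-1 <= e.
Proof.
move=> e0; exists (Num.trunc e^-1) => n Nn.
rewrite -[leRHS]invrK lef_pV2 ?posrE ?invr_gt0//.
apply: ltW; apply: lt_le_trans (truncnS_gt _) _.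
by rewrite ler_nat ltnS.
Qed.

(** * Norm limits of sequences and the Riesz representation *)

Section Limits.
Local Open Scope complex_scope.
Variables (R : realType) (H : hilbertType R).
Implicit Types (x y z : H) (a b c e : R) (T : H -> H).

Local Notation nr := (@realnorm R H).

Definition nlim (u : nat -> H) l := forall e, 0 < e ->
  exists N, forall n, (N <= n)%N -> nr (u n - l) <= e.

(** The one place where completeness of [H] enters. *)
Lemma nlim_ex (u : nat -> H) :
  (forall e, 0 < e -> exists N, forall n m, (N <= n)%N -> (N <= m)%N ->
    nr (u n - u m) <= e) -> exists l, nlim u l.
Proof.
move=> uC.
have /cauchy_exP/cauchy_cvg/cvg_ex[l /cvgrPdist_le ul] : cauchy_ex (u @ \oo).
  move=> eps eps0.
  have epsE : eps = (complex.Re eps)%:C by rewrite RRe_real ?gtr0_real.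
  have e0 : 0 < complex.Re eps by rewrite -ltcR -epsE.
  (* Balls are open while the Cauchy bound is not strict; halving the radius leaves room. *)
  have [N uN] := uC _ (divr_gt0 e0 (@ltr0n _ 2)).
  exists (u N); exists N => // n /= Nn.
  rewrite -ball_normE /= normE epsE ltcR (le_lt_trans (uN _ _ _ Nn))//.
  by rewrite ltr_pdivrMr// ltr_pMr// ltr1n.
exists l => e e0; have /ul[N _ uN] : 0 < e%:C :> R[i] by rewrite ltcR.
by exists N => n Nn; rewrite nrC -lecR -normE; exact: uN.
Qed.

Lemma nlim_const x : nlim (fun=> x) x.
Proof. by move=> e e0; exists 0%N => n _; rewrite subrr nr0 ltW. Qed.

Lemma nlim_eps (u : nat -> H) l e : nlim u l -> 0 < e -> exists n, nr (u n - l) <= e.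
Proof. by move=> ul /ul[N uN]; exists N; exact: uN. Qed.

Lemma nlim_uniq (u : nat -> H) l m : nlim u l -> nlim u m -> l = m.
Proof.
move=> ul um; apply/subr0_eq/nr_eq0/le_anti; rewrite nr_ge0 andbT.
apply: (@le_eps _ 2) => e e0; have [N uN] := ul _ e0; have [M uM] := um _ e0.
apply: le_trans (nrB _ _ (u (maxn N M))) _.
rewrite add0r mulr2n mulrDl !mul1r lerD//; last by rewrite uM// leq_maxr.
by rewrite nrC uN// leq_maxl.
Qed.

Lemma nlim_lin (u v : nat -> H) l m (k : R[i]) : nlim u l -> nlim v m ->
  nlim (fun n => k *: u n + v n) (k *: l + m).
Proof.
move=> ul vm e e0; pose c := complex.Re `|k|.
have c0 : 0 <= c by rewrite -ler0c RRe_real ?normr_real.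
have c1 : 0 < c + 1 by rewrite ltr_wpDl.
have [N uN] := ul _ (divr_gt0 e0 (mulr_gt0 (@ltr0n R 2) c1)).
have [M vM] := vm _ (divr_gt0 e0 (@ltr0n R 2)).
exists (maxn N M) => n; rewrite geq_max => /andP[Nn Mn].
rewrite opprD addrACA -scalerBr (le_trans (nrD _ _))// nrZ -/c.
have := uN _ Nn; have := vM _ Mn; move: (nr (u n - l)) (nr (v n - m)) => s t t_le s_le.
rewrite [leRHS](splitr e) lerD//.
apply: le_trans (ler_wpM2l c0 s_le) _.
rewrite mulrA ler_pdivrMr ?mulr_gt0// mulrA divfK// mulrC ler_wpM2l ?(ltW e0)//.
by rewrite lerDl.
Qed.

Lemma nlim_bounded T M (u : nat -> H) l : linear T ->
  (forall x, nr (T x) <= M * nr x) -> nlim u l -> nlim (T \o u) (T l).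
Proof.
move=> linT TM ul e e0; have M1 : 0 < `|M| + 1 by rewrite ltr_wpDl.
have [N uN] := ul _ (divr_gt0 e0 M1); exists N => n Nn /=.
have -> : T (u n) - T l = T (u n - l).
  by rewrite [u n - l]addrC -(scaleN1r l) linT scaleN1r addrC.
apply: le_trans (TM _) _; apply: (@le_trans _ _ ((`|M| + 1) * nr (u n - l))).
  by rewrite ler_wpM2r ?nr_ge0// (le_trans (ler_norm _))// lerDl.
by rewrite -ler_pdivlMl// mulrC uN.
Qed.

Lemma nlim_rip_le (u : nat -> H) l z M : nlim u l ->
  (forall n, rip (u n) z <= M) -> rip l z <= M.
Proof.
move=> ul uM; apply: (@le_eps _ (nr z)) => e e0; have [n un] := nlim_eps ul e0.
rewrite -(subrK (u n) l) ripDl addrC lerD//.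
by rewrite (le_trans (rip_le _ _))// mulrC ler_wpM2l ?nr_ge0// nrC.
Qed.

Lemma nlim_rip_eq (u : nat -> H) l z M : nlim u l ->
  (forall n, rip (u n) z = M) -> rip l z = M.
Proof.
move=> ul uM; apply/le_anti/andP; split.
  by apply: nlim_rip_le ul _ => n; rewrite uM.
rewrite -lerN2 -ripNr; apply: nlim_rip_le ul _ => n.
by rewrite ripNr uM.
Qed.

(** The representing vector minimises |x|^2 - 2 f(x), which equals |x - z|^2 - |z|^2 when f = <.,
    z>. *)
Lemma riesz (f : H -> R) M :
  (forall a x y, f (a%:C *: x + y) = a * f x + f y) ->
  (forall x, f x <= M * nr x) ->
  exists z, forall x, f x = rip x z.
Proof.
move=> linf fM.
have fZ a x : f (a%:C *: x) = a * f x.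
  have f0 : f 0 = 0 by have := linf (-1) 0 0; rewrite scaler0 addr0 mulN1r addNr.
  by have := linf a x 0; rewrite f0 !addr0.
have fD x y : f (x + y) = f x + f y by have := linf 1 x y; rewrite scale1r mul1r.
pose J x := nr x ^+ 2 - 2 * f x.
have JM x : - M ^+ 2 <= J x.
  rewrite /J; have := fM x; have := sqr_ge0 (nr x - M); rewrite sqrrB; move: (f x) (nr x) => F N; lra.
have hasJ : has_inf (range J) by split; [exists (J 0), 0|exists (- M ^+ 2) => _ [x _ <-]].
pose d := inf (range J).
have dJ x : d <= J x by apply: ge_inf; [case: hasJ|exists x].
have JD x h t : J (x + t%:C *: h) = J x + 2 * t * (rip x h - f h) + t ^+ 2 * nr h ^+ 2.
  by rewrite /J nr_sqrD fD fZ nrZr ripZr exprMn real_normK ?num_real//; ring.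
(* The parallelogram law in disguise: [J] is at least [d] at the midpoint, so two almost minimising
   points are close to each other. *)
have Jmid x y : nr (x - y) ^+ 2 <= 2 * (J x - d) + 2 * (J y - d).
  have := dJ (x + 2^-1%:C *: (y - x)); rewrite JD => dm.
  have : J y = J x + 2 * (rip x (y - x) - f (y - x)) + nr (y - x) ^+ 2.
    by have := JD x (y - x) 1; rewrite scale1r subrKC mulr1 expr1n mul1r.
  by rewrite (nrC x y); move: dm; lra.
have [u uP] : exists u : nat -> H, forall n, J (u n) <= d + n.+1%:R^-1.
  suff /choice[u uP] : forall n : nat, exists x, J x <= d + n.+1%:R^-1 by exists u.
  move=> n.
  have n0 : 0 < n.+1%:R^-1 :> R by rewrite invr_gt0 ltr0n.
  have [_ [x _ <-] xd] := inf_adherent n0 hasJ.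
  by exists x; apply: ltW.
have [z uz] : exists z, nlim u z.
  apply: nlim_ex => e e0.
  have [N Ne] := inv_natS_le (divr_gt0 (exprn_gt0 2 e0) (@ltr0n R 4)).
  exists N => n m /Ne ne /Ne me.
  rewrite -(@ler_pXn2r _ 2)// ?nnegrE ?nr_ge0 ?(ltW e0)//.
  apply: le_trans (Jmid _ _) _; have := uP n; have := uP m.
  by move: ne me; move: n.+1%:R^-1 m.+1%:R^-1 (e ^+ 2) => p q E; lra.
exists z => x; apply/esym/subr0_eq; set c := rip x z - f x.
have Q t : 0 <= t ^+ 2 * nr x ^+ 2 + 2 * t * c.
  apply: (@le_eps _ (1 + 2 * `|t| * nr x)) => e e0.
  have [N uN] := uz _ e0; have [N' Ne] := inv_natS_le e0.
  have {uN} := uN _ (leq_maxl N N'); have {Ne} := Ne _ (leq_maxr N N').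
  move: (maxn N N') => n ne une.
  have := le_trans (uP n) (lerD (lexx d) ne); have := dJ (u n + t%:C *: x).
  rewrite JD => h1 h2.
  have h3 : t * (rip (u n) x - f x) <= t * c + `|t| * nr x * e.
    rewrite -lerBlDl -mulrBr; apply: le_trans (ler_norm _) _.
    rewrite normrM -mulrA ler_wpM2l//.
    rewrite /c [rip x z]ripC opprB addrA addrNK -ripBl.
    by rewrite (le_trans (rip_norm_le _ _))// mulrC ler_wpM2l ?nr_ge0.
  by move: h1 h2 h3; lra.
have X1 : 0 < nr x ^+ 2 + 1 by rewrite ltr_wpDl ?sqr_ge0.
apply/eqP; rewrite -sqrf_eq0; apply/eqP/le_anti; rewrite sqr_ge0 andbT.
(* The minimiser of the quadratic would be -c / |x|^2; the added 1 covers x = 0 and still gives a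
   negative value unless c = 0. *)
have := Q (- c / (nr x ^+ 2 + 1)).
move: X1 (sqr_ge0 (nr x)); move: (nr x ^+ 2) => X X1 X0.
have -> : (- c / (X + 1)) ^+ 2 * X + 2 * (- c / (X + 1)) * c =
  - (c ^+ 2) * ((X + 2) / (X + 1) ^+ 2) by field; rewrite lt0r_neq0.
by rewrite pmulr_lge0 ?oppr_ge0// divr_gt0 ?exprn_gt0//; lra.
Qed.

End Limits.

(** * Bounded operators, operator norm, numerical radius and adjoints *)

Section Operators.
Local Open Scope complex_scope.
Variables (R : realType) (H : hilbertType R).
Implicit Types (x y z : H) (a b c e M : R) (A B S T U : H -> H) (k : R[i]).

Local Notation nr := (@realnorm R H).

Definition bounded_by T M := forall x, nr (T x) <= M * nr x.

Lemma linD T x y : linear T -> T (x + y) = T x + T y.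
Proof. by move=> linT; rewrite -{1}(scale1r x) linT scale1r. Qed.

Lemma lin0 T : linear T -> T 0 = 0.
Proof. by move=> linT; apply: (addrI (T 0)); rewrite -linD// !addr0. Qed.

Lemma linZ T k x : linear T -> T (k *: x) = k *: T x.
Proof. by move=> linT; rewrite -{1}(addr0 (k *: x)) linT lin0// addr0. Qed.

Lemma linN T x : linear T -> T (- x) = - T x.
Proof. by move=> linT; rewrite -scaleN1r linZ// scaleN1r. Qed.

Lemma linB T x y : linear T -> T (x - y) = T x - T y.
Proof. by move=> linT; rewrite linD// linN. Qed.

Lemma lin_comp A B : linear A -> linear B -> linear (A \o B).
Proof. by move=> linA linB k x y; rewrite /= linB linA. Qed.

Lemma lin_add A B : linear A -> linear B -> linear (A \+ B).
Proof.
by move=> linA linB k x y; rewrite /= linA linB scalerDr !addrA; congr (_ + _); rewrite addrAC.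
Qed.

Lemma lin_scale A k : linear A -> linear (fun x => k *: A x).
Proof. by move=> linA l x y; rewrite linA scalerDr !scalerA mulrC. Qed.

Lemma bounded_by_le T M M' : bounded_by T M -> M <= M' -> bounded_by T M'.
Proof. by move=> TM MM' x; rewrite (le_trans (TM x))// ler_wpM2r ?nr_ge0. Qed.

Lemma bounded_by_comp A B M M' : 0 <= M -> bounded_by A M -> bounded_by B M' ->
  bounded_by (A \o B) (M * M').
Proof. by move=> M0 AM BM x; rewrite (le_trans (AM _))// -mulrA ler_wpM2l. Qed.

Lemma bounded_by_add A B M M' : bounded_by A M -> bounded_by B M' ->
  bounded_by (A \+ B) (M + M').
Proof. by move=> AM BM x; rewrite (le_trans (nrD _ _))// mulrDl lerD. Qed.

Lemma bounded_by_scale A M k : bounded_by A M ->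
  bounded_by (fun x => k *: A x) (complex.Re `|k| * M).
Proof.
by move=> AM x; rewrite nrZ -mulrA ler_wpM2l// -ler0c RRe_real ?normr_real.
Qed.

Lemma bounded_byP T M : linear T -> bounded_by T M -> bounded_operator T.
Proof.
by move=> linT TM; split=> //; exists M => x; rewrite norm_leE TM.
Qed.

Lemma bounded_lin T : bounded_operator T -> linear T.
Proof. by case. Qed.

Lemma bounded_ex T : bounded_operator T -> exists2 M, 0 <= M & bounded_by T M.
Proof.
move=> [_ [M TM]]; exists `|M| => // x; apply: (@le_trans _ _ (M * nr x)).
  by rewrite -norm_leE TM.
by rewrite ler_wpM2r ?nr_ge0 ?ler_norm.
Qed.

Lemma bounded_comp A B : bounded_operator A -> bounded_operator B ->
  bounded_operator (A \o B).
Proof.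
move=> bA bB; have [M M0 AM] := bounded_ex bA; have [M' _ BM] := bounded_ex bB.
apply: bounded_byP (bounded_by_comp M0 AM BM).
by apply: lin_comp; exact: bounded_lin.
Qed.

Lemma bounded_add A B : bounded_operator A -> bounded_operator B ->
  bounded_operator (A \+ B).
Proof.
move=> bA bB; have [M M0 AM] := bounded_ex bA; have [M' _ BM] := bounded_ex bB.
apply: bounded_byP (bounded_by_add AM BM).
by apply: lin_add; exact: bounded_lin.
Qed.

Lemma bounded_scale A k : bounded_operator A -> bounded_operator (fun x => k *: A x).
Proof.
move=> bA; have [M M0 AM] := bounded_ex bA.
apply: bounded_byP (bounded_by_scale k AM).
by apply: lin_scale; exact: bounded_lin.
Qed.

(** On the zero space the unit sphere is empty and the supremum is 0, hence the sign condition on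
    [M] here and in [opnorm_le] and [numradius_le]. *)
Lemma sup_le_ge0 (E : set R) M : 0 <= M -> (forall r : R, E r -> r <= M) -> sup E <= M.
Proof.
move=> M0 EM; have [->|E0] := eqVneq E set0; first by rewrite sup0.
by apply: ge_sup => //; exact/set0P.
Qed.

Lemma nr_unit x : x != 0 -> nr ((nr x)^-1%:C *: x) = 1.
Proof.
by move=> /nr_gt0 x0; rewrite nrZr ger0_norm ?invr_ge0 ?nr_ge0// mulVf ?gt_eqF.
Qed.

Lemma norm1_nr x : (`|x| = 1) <-> (nr x = 1).
Proof. by rewrite normE; split => [/complexI//|->]. Qed.

Lemma opnorm_ub T : bounded_operator T -> bounded_by T (opnorm T).
Proof.
move=> bT x; have linT := bounded_lin bT; have [M M0 TM] := bounded_ex bT.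
have [->|x0] := eqVneq x 0; first by rewrite lin0// nr0 mulr0.
have nx := nr_gt0 x0; rewrite -ler_pdivrMr//.
have -> : nr (T x) / nr x = nr (T ((nr x)^-1%:C *: x)).
  by rewrite linZ// nrZr ger0_norm ?invr_ge0 ?nr_ge0// mulrC.
apply: ub_le_sup; last first.
  by exists ((nr x)^-1%:C *: x) => //=; apply/norm1_nr; rewrite nr_unit.
by exists M => _ [y /norm1_nr y1 <-]; rewrite (le_trans (TM y))// y1 mulr1.
Qed.

Lemma opnorm_le T M : 0 <= M -> bounded_by T M -> opnorm T <= M.
Proof.
move=> M0 TM; apply: sup_le_ge0 => // _ [y /norm1_nr y1 <-].
by rewrite (le_trans (TM y))// y1 mulr1.
Qed.

Lemma opnorm_ge0 T : bounded_operator T -> 0 <= opnorm T.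
Proof.
move=> bT; have [M M0 TM] := bounded_ex bT.
case: (pselect (exists x : H, `|x| = 1)) => [[x x1]|nx].
  have := opnorm_ub bT x; rewrite (iffLR (norm1_nr x) x1) mulr1.
  by apply: le_trans; exact: nr_ge0.
rewrite /opnorm; set E := (X in sup X); suff -> : E = set0 by rewrite sup0.
by rewrite -subset0; move=> r [x x1 _]; apply: nx; exists x.
Qed.

Lemma numradius_ub T x k : bounded_operator T -> complex.Re `|k| = 1 ->
  rip (k *: T x) x <= numradius T * nr x ^+ 2.
Proof.
move=> bT k1; have linT := bounded_lin bT; have [M M0 TM] := bounded_ex bT.
have [->|x0] := eqVneq x 0; first by rewrite rip0r nr0 expr0n mulr0.
have nx := nr_gt0 x0; rewrite -ler_pdivrMr ?exprn_gt0//.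
set y := (nr x)^-1%:C *: x.
have -> : rip (k *: T x) x / nr x ^+ 2 = rip (k *: T y) y.
  rewrite /y linZ// scalerA [k * _]mulrC -scalerA ripZl ripZr.
  by field; rewrite gt_eqF.
apply: le_trans (rip_le_norm _ _ k1) _.
apply: ub_le_sup; last by exists y => //=; apply/norm1_nr; rewrite nr_unit.
exists M => _ [z /norm1_nr z1 <-]; have [u [u1 ->]] := Re_norm_inner (T z) z.
rewrite (le_trans (rip_le _ _))// z1 mulr1 nrZ u1 mul1r.
by rewrite (le_trans (TM z))// z1 mulr1.
Qed.

Lemma numradius_le T M : 0 <= M ->
  (forall x k, nr x = 1 -> complex.Re `|k| = 1 -> rip (k *: T x) x <= M) ->
  numradius T <= M.
Proof.
move=> M0 TM; apply: sup_le_ge0 => // _ [x /norm1_nr x1 <-].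
by have [u [u1 ->]] := Re_norm_inner (T x) x; exact: TM.
Qed.

Lemma numradius_ge0 T : bounded_operator T -> 0 <= numradius T.
Proof.
move=> bT; case: (pselect (exists x : H, nr x = 1)) => [[x x1]|nx]; last first.
  rewrite /numradius; set E := (X in sup X); suff -> : E = set0 by rewrite sup0.
  by rewrite -subset0; move=> r [x /norm1_nr x1 _]; apply: nx; exists x.
have [u [u1 h]] := Re_norm_inner (T x) x.
have := numradius_ub x bT u1; rewrite -h x1 expr1n mulr1; apply: le_trans.
by rewrite -ler0c RRe_real ?normr_real.
Qed.

(** Real parts decide: Im <u, v> = - Re <iu, v>, and [T] commutes with multiplication by i. *)
Lemma is_adjoint_rip T S : linear T ->
  (forall x y, rip (T x) y = rip x (S y)) -> is_adjoint T S.
Proof.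
move=> linT TS x y; apply/eqP; rewrite eq_complex; apply/andP; split; apply/eqP.
  exact: TS.
have Im_i u v : complex.Im (inner u v) = - rip ('i *: u) v.
  by rewrite /rip innerZl; case: (inner u v) => p q /=; ring.
by rewrite !Im_i -linZ// TS.
Qed.

Lemma adjoint_ex T : bounded_operator T -> exists S, is_adjoint T S.
Proof.
move=> bT; have linT := bounded_lin bT; have [M M0 TM] := bounded_ex bT.
have /choice[S TS] : forall y, exists z, forall x, rip (T x) y = rip x z.
  move=> y; apply: (@riesz _ _ (fun x => rip (T x) y) (M * nr y)) => [a x z|x].
    by rewrite linT ripDl ripZl.
  rewrite (le_trans (rip_le _ _))// mulrAC ler_wpM2r ?nr_ge0//.
by exists S; apply: is_adjoint_rip.
Qed.

Lemma adjointP T : bounded_operator T -> is_adjoint T (adjoint T).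
Proof. by move=> /adjoint_ex[S TS]; apply: (@xgetI _ _ _ S). Qed.

Lemma adjoint_rip T x y : bounded_operator T -> rip (T x) y = rip x (adjoint T y).
Proof. by move=> bT; rewrite /rip adjointP. Qed.

Lemma adjoint_ripC T x y : bounded_operator T -> rip (adjoint T x) y = rip x (T y).
Proof. by move=> bT; rewrite ripC -adjoint_rip// ripC. Qed.

Lemma adjoint_lin T : bounded_operator T -> linear (adjoint T).
Proof.
move=> bT k x y; apply: rip_eq => z; rewrite ripC [RHS]ripC.
rewrite -adjoint_rip// !ripDr -adjoint_rip//; congr (_ + _).
by rewrite /rip !innerZr adjointP.
Qed.

(** Pair with [A x] itself: |Ax|^2 = <x, B(Ax)> <= M |x| |Ax|, then divide by |Ax|. *)
Lemma dual_bounded_by A B M : 0 <= M -> (forall x y, rip (A x) y = rip x (B y)) ->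
  bounded_by B M -> bounded_by A M.
Proof.
move=> M0 AB BM x; have [->|x0] := eqVneq (A x) 0.
  by rewrite nr0 mulr_ge0 ?nr_ge0.
rewrite -(ler_pM2r (nr_gt0 x0)) -expr2 -ripxx AB.
by rewrite (le_trans (rip_le _ _))// -mulrA mulrCA ler_wpM2l ?nr_ge0.
Qed.

Lemma adjoint_bounded_by T M : 0 <= M -> bounded_operator T -> bounded_by T M ->
  bounded_by (adjoint T) M.
Proof.
by move=> M0 bT TM; apply: dual_bounded_by TM => // x y; rewrite adjoint_ripC.
Qed.

Lemma adjoint_bounded T : bounded_operator T -> bounded_operator (adjoint T).
Proof.
move=> bT; have [M M0 TM] := bounded_ex bT.
by apply: bounded_byP (adjoint_bounded_by M0 bT TM); exact: adjoint_lin.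
Qed.

(** Polarisation, 4 Re <Ay, z> = <A(y+z), y+z> - <A(y-z), y-z>, followed by the parallelogram
    law. *)
Lemma sym_norm_le A M : 0 <= M -> linear A ->
  (forall x y, rip (A x) y = rip x (A y)) ->
  (forall x, `|rip (A x) x| <= M * nr x ^+ 2) -> bounded_by A M.
Proof.
move=> M0 linA symA AM x.
have [->|Ax0] := eqVneq (A x) 0; first by rewrite nr0 mulr_ge0 ?nr_ge0.
have [->|x0] := eqVneq x 0; first by rewrite lin0// nr0 mulr0.
have P y z : 2 * rip (A y) z <= M * (nr y ^+ 2 + nr z ^+ 2).
  have := le_trans (ler_norm _) (AM (y + z)).
  have := AM (y - z); rewrite ler_norml => /andP[+ _].
  rewrite (nr_sqrD y z) (nr_sqrB y z) (linD y z linA) (linB y z linA) !ripDl !ripNl !ripDr !ripNr.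
  rewrite (ripC (A z) y) -symA; lra.
(* The two vectors are scaled to the common length |x| |Ax|, where the bound of [P] is sharp. *)
have := P ((nr (A x))%:C *: x) ((nr x)%:C *: A x).
rewrite linZ// ripZl ripZr ripxx !nrZr !ger0_norm ?nr_ge0//.
move: (nr_gt0 x0) (nr_gt0 Ax0); move: (nr x) (nr (A x)) => s t s0 t0.
have -> : 2 * (t * (s * t ^+ 2)) = t * (2 * s * t ^+ 2) by ring.
have -> : M * ((t * s) ^+ 2 + (s * t) ^+ 2) = (M * s) * (2 * s * t ^+ 2) by ring.
by rewrite ler_pM2r// !mulr_gt0.
Qed.

End Operators.

(** * Polynomials in a positive operator *)

Section PolynomialCalculus.
Local Open Scope complex_scope.
Variables (R : realType) (H : hilbertType R).
Implicit Types (x y z : H) (a b c e M : R) (A B : H -> H).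

Local Notation nr := (@realnorm R H).

(** Complex coefficients let a real polynomial split into linear factors in [bounded_below_poly]. *)
Definition cpoly_op (p : {poly R[i]}) A x := \sum_(i < size p) p`_i *: iter i A x.

Lemma cpoly_op_wide n (p : {poly R[i]}) A x : (size p <= n)%N ->
  cpoly_op p A x = \sum_(i < n) p`_i *: iter i A x.
Proof.
move=> pn; pose F i := p`_i *: iter i A x.
transitivity (\sum_(i < n | (i < size p)%N) F i); first exact: big_ord_widen.
rewrite big_mkcond; apply: eq_bigr => i _; case: ltnP => // pi.
by rewrite /F nth_default// scale0r.
Qed.

Lemma cpoly_opC k A x : cpoly_op k%:P A x = k *: x.
Proof.
by rewrite (@cpoly_op_wide 1) ?size_polyC_leq1// big_ord1 coefC.
Qed.

Lemma cpoly_opD p q A x : cpoly_op (p + q) A x = cpoly_op p A x + cpoly_op q A x.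
Proof.
rewrite !(@cpoly_op_wide (maxn (size p) (size q))) ?size_polyD ?leq_maxl ?leq_maxr//.
by rewrite -big_split; apply: eq_bigr => i _; rewrite coefD scalerDl.
Qed.

Lemma cpoly_opMX p A x : cpoly_op (p * 'X) A x = cpoly_op p A (A x).
Proof.
rewrite (@cpoly_op_wide (size p).+1); last first.
  by rewrite (leq_trans (size_polyMleq _ _))// size_polyX addn2.
rewrite big_ord_recl coefMX eqxx scale0r add0r.
by apply: eq_bigr => i _; rewrite coefMX -iterSr.
Qed.

Lemma cpoly_opX A x : cpoly_op 'X A x = A x.
Proof. by rewrite -(mul1r 'X) cpoly_opMX -polyC1 cpoly_opC scale1r. Qed.

Lemma cpoly_op_lin p A : linear A -> linear (cpoly_op p A).
Proof.
move=> linA; elim/poly_ind: p => [|p c IH] k x y.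
  by rewrite -polyC0 !cpoly_opC !scale0r scaler0 addr0.
rewrite !cpoly_opD !cpoly_opMX !cpoly_opC linA IH !scalerDr !scalerA mulrC.
by rewrite addrACA.
Qed.

Lemma cpoly_op_comm p A x : linear A -> cpoly_op p A (A x) = A (cpoly_op p A x).
Proof.
move=> linA; elim/poly_ind: p x => [|p c IH] x.
  by rewrite -polyC0 !cpoly_opC !scale0r lin0.
by rewrite !cpoly_opD !cpoly_opMX !cpoly_opC (linD _ _ linA) (linZ _ _ linA) IH.
Qed.

Lemma cpoly_opM p q A x : linear A ->
  cpoly_op (p * q) A x = cpoly_op p A (cpoly_op q A x).
Proof.
move=> linA; elim/poly_ind: p x => [|p c IH] x.
  by rewrite mul0r -polyC0 !cpoly_opC !scale0r.
rewrite mulrDl -mulrA (mulrC 'X) mulrA !cpoly_opD !cpoly_opMX IH cpoly_op_comm//.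
congr (_ + _); rewrite cpoly_opC mul_polyC.
rewrite (@cpoly_op_wide (size q)) ?size_scale_leq// /cpoly_op scaler_sumr.
by apply: eq_bigr => i _; rewrite coefZ scalerA.
Qed.

Lemma poly_opE (p : {poly R}) A x :
  poly_op p A x = cpoly_op (map_poly (real_complex R) p) A x.
Proof.
rewrite /poly_op /cpoly_op size_map_poly.
by apply: eq_bigr => i _; rewrite coef_map.
Qed.

Lemma poly_opC a A x : poly_op a%:P A x = a%:C *: x.
Proof. by rewrite poly_opE map_polyC cpoly_opC. Qed.

Lemma poly_op1 A x : poly_op 1 A x = x.
Proof. by rewrite -polyC1 poly_opC scale1r. Qed.

Lemma poly_opD (p q : {poly R}) A x :
  poly_op (p + q) A x = poly_op p A x + poly_op q A x.
Proof. by rewrite !poly_opE rmorphD cpoly_opD. Qed.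

Lemma poly_opMX (p : {poly R}) A x : poly_op (p * 'X) A x = poly_op p A (A x).
Proof. by rewrite !poly_opE rmorphM/= map_polyX cpoly_opMX. Qed.

Lemma poly_opX A x : poly_op 'X A x = A x.
Proof. by rewrite -(mul1r 'X) poly_opMX -polyC1 poly_opC scale1r. Qed.

Lemma poly_opM (p q : {poly R}) A x : linear A ->
  poly_op (p * q) A x = poly_op p A (poly_op q A x).
Proof. by move=> linA; rewrite !poly_opE rmorphM/= cpoly_opM. Qed.

Lemma poly_opN (p : {poly R}) A x : linear A -> poly_op (- p) A x = - poly_op p A x.
Proof.
move=> linA; rewrite -mulN1r -polyC1 -polyCN poly_opM// poly_opC.
by rewrite rmorphN1 scaleN1r.
Qed.

Lemma poly_opB (p q : {poly R}) A x : linear A ->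
  poly_op (p - q) A x = poly_op p A x - poly_op q A x.
Proof. by move=> linA; rewrite poly_opD poly_opN. Qed.

Lemma poly_op_lin (p : {poly R}) A : linear A -> linear (poly_op p A).
Proof. by move=> linA k x y; rewrite !poly_opE cpoly_op_lin. Qed.

Lemma poly_op_bounded (p : {poly R}) A : bounded_operator A ->
  bounded_operator (poly_op p A).
Proof.
move=> bA; have linA := bounded_lin bA; have [M M0 AM] := bounded_ex bA.
suff [K pK] : exists K, bounded_by (poly_op p A) K.
  by apply: bounded_byP pK; exact: poly_op_lin.
elim/poly_ind: p => [|p c [K pK]].
  by exists 0 => x; rewrite -polyC0 poly_opC scale0r nr0 mul0r.
exists (`|K| * M + `|c|) => x; rewrite poly_opD poly_opMX poly_opC.
rewrite (le_trans (nrD _ _))// mulrDl nrZr lerD// (le_trans (pK _))//.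
apply: (@le_trans _ _ (`|K| * nr (A x))); first by rewrite ler_wpM2r ?nr_ge0 ?ler_norm.
by rewrite -mulrA ler_wpM2l.
Qed.

Definition symmetric_op A := forall x y, rip (A x) y = rip x (A y).

Lemma poly_op_sym (p : {poly R}) A : linear A -> symmetric_op A ->
  symmetric_op (poly_op p A).
Proof.
move=> linA symA; elim/poly_ind: p => [|p c IH] x y.
  by rewrite -polyC0 !poly_opC !ripZl !ripZr !mul0r.
rewrite !poly_opD !poly_opMX !poly_opC ripDl ripDr ripZl ripZr; congr (_ + _).
by rewrite IH symA !poly_opE cpoly_op_comm.
Qed.

Definition positive_op A :=
  [/\ bounded_operator A, symmetric_op A & forall x, 0 <= rip (A x) x].

(** Since <Ax, x> is real, pairing [A x - k x] with ix leaves only Im k, which settles the nonreal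
    case. For real k, pairing with x uses <Ax, x> >= 0 when k < 0, and <Ax, x> <= ||A|| |x|^2 when k
    > ||A||. *)
Lemma bounded_below_sub A (k : R[i]) : positive_op A ->
  ~~ ((complex.Im k == 0) && (0 <= complex.Re k <= opnorm A)) ->
  exists2 c, 0 < c & forall x, c * nr x <= nr (A x - k *: x).
Proof.
move=> [bA symA posA] kA; have linA := bounded_lin bA.
pose u := complex.Re k; pose v := complex.Im k.
have ReA x : rip (A x - k *: x) x = rip (A x) x - u * nr x ^+ 2.
  rewrite ripBl; congr (_ - _).
  rewrite /rip innerZl -inner_norm normE -rmorphXn /u; case: (k) => s t /=.
  by rewrite mulr0 subr0.
have ImA x : rip (A x - k *: x) ('i *: x) = - (v * nr x ^+ 2).
  rewrite ripBl; have -> : rip (A x) ('i *: x) = 0.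
    have : rip (A x) ('i *: x) = - rip (A x) ('i *: x).
      rewrite {1}symA linZ// -!rip_i innerC; by case: (inner (A x) x).
    lra.
  rewrite sub0r; congr (- _).
  rewrite /rip innerZl innerZr -inner_norm normE -rmorphXn /v.
  by case: (k) => s t /=; ring.
suff [c c0 cA] : exists2 c, 0 < c & forall x, c * nr x ^+ 2 <= nr (A x - k *: x) * nr x.
  exists c => // x; have [->|x0] := eqVneq x 0; first by rewrite nr0 mulr0 nr_ge0.
  by rewrite -(ler_pM2r (nr_gt0 x0)) -mulrA -expr2.
have [v0|v0] := eqVneq v 0; last first.
  exists `|v|; first by rewrite normr_gt0.
  move=> x; have -> : nr x = nr ('i *: x).
    by rewrite nrZ normc_def /= expr0n expr1n add0r sqrtr1 mul1r.
  apply: le_trans (rip_norm_le _ _); rewrite ImA normrN normrM.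
  by rewrite nrZ normc_def /= expr0n expr1n add0r sqrtr1 mul1r [X in _ <= _ * X]ger0_norm ?sqr_ge0.
move: kA; rewrite -/u -/v v0 eqxx /= negb_and -!ltNge => /orP[u0|u0].
  exists (- u); first by rewrite oppr_gt0.
  move=> x; apply: le_trans (rip_le _ _); rewrite ReA mulNr.
  by have := posA x; lra.
exists (u - opnorm A); first by rewrite subr_gt0.
move=> x; rewrite -(nrN (_ - _)); apply: le_trans (rip_le _ _).
rewrite ripNl ReA mulrBl opprB lerD2l lerN2 (le_trans (rip_le _ _))//.
by rewrite expr2 mulrA ler_wpM2r ?nr_ge0// opnorm_ub.
Qed.

(** Over the complex numbers q is a product of linear factors, none with its root in the interval.
    Each factor is bounded below, and lower bounds multiply under composition. This plays the part
    of the spectral mapping theorem. *)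
Lemma bounded_below_poly A (q : {poly R}) : positive_op A ->
  (forall s : R, 0 <= s <= opnorm A -> q.[s] != 0) ->
  exists2 c, 0 < c & forall x, c * nr x <= nr (poly_op q A x).
Proof.
move=> pA q0; have [bA _ _] := pA; have linA := bounded_lin bA.
have qn0 : q != 0.
  apply: contraTneq (q0 0 _); last by rewrite lexx opnorm_ge0.
  by move=> ->; rewrite horner0 eqxx.
have [rs rsE] := closed_field_poly_normal (map_poly (real_complex R) q).
pose l := lead_coef (map_poly (real_complex R) q).
have l0 : l != 0 by rewrite lead_coef_eq0 map_poly_eq0.
have rsA : all (fun k => ~~ ((complex.Im k == 0) && (0 <= complex.Re k <= opnorm A))) rs.
  apply/allP => k krs; apply/negP => /andP[/eqP Im0 kA].
  have kE : k = (complex.Re k)%:C by move: Im0; case: (k) => s t /= ->.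
  have : root (map_poly (real_complex R) q) k.
    by rewrite rsE rootE hornerZ mulf_eq0 -[X in _ || X]rootE root_prod_XsubC krs orbT.
  by rewrite kE rootE horner_map /= fmorph_eq0; apply/negP/q0.
have [c c0 cA] : exists2 c, 0 < c &
    forall x, c * nr x <= nr (cpoly_op (\prod_(z <- rs) ('X - z%:P)) A x).
  elim: rs rsA {rsE} => [_|k rs IH /= /andP[kA /IH[c c0 cA]]].
    exists 1 => // x; rewrite big_nil -polyC1 cpoly_opC scale1r mul1r//.
  have [d d0 dA] := bounded_below_sub pA kA.
  exists (d * c); first exact: mulr_gt0.
  move=> x; rewrite big_cons cpoly_opM// cpoly_opD -polyCN cpoly_opC.
  rewrite cpoly_opX scaleNr.
  by apply: le_trans (dA _); rewrite -mulrA ler_wpM2l ?(ltW d0).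
have nl : 0 < complex.Re `|l| by rewrite -ltcR RRe_real ?normr_real// normr_gt0.
exists (complex.Re `|l| * c); first exact: mulr_gt0.
move=> x; rewrite poly_opE rsE -mul_polyC cpoly_opM// cpoly_opC nrZ -mulrA.
by rewrite ler_pM2l.
Qed.

(* If [M = opnorm (p A)] exceeded the bound of [p], then [M ^ 2 - p ^ 2] would have
   no root in the interval, so [M ^ 2 - (p A) ^ 2] would be bounded below; but it is
   small on unit vectors where [p A] almost attains its norm. *)
Lemma poly_op_bound A (p : {poly R}) M : positive_op A ->
  (forall s : R, 0 <= s <= opnorm A -> `|p.[s]| <= M) ->
  bounded_by (poly_op p A) M.
Proof.
move=> pA pM; have [bA symA _] := pA; have linA := bounded_lin bA.
have bp := poly_op_bounded p bA; have symp := poly_op_sym p linA symA.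
suff pleM : opnorm (poly_op p A) <= M by exact: bounded_by_le (opnorm_ub bp) pleM.
rewrite leNgt; apply/negP; set N := opnorm _ => MN.
have M0 : 0 <= M by apply: le_trans (pM 0 _); rewrite ?normr_ge0// lexx opnorm_ge0.
have N0 : 0 < N by exact: le_lt_trans MN.
have [s sA|c c0 cA] := bounded_below_poly (q := (N ^+ 2)%:P - p * p) pA.
  rewrite !hornerE subr_eq0 gt_eqF// -expr2 -real_normK ?num_real//.
  rewrite ltr_pXn2r ?nnegrE ?normr_ge0 ?(ltW N0)//.
  exact: le_lt_trans (pM _ sA) MN.
(* With B = p(A), c^2 |x|^2 <= |(N^2 - B^2) x|^2 <= N^4 |x|^2 - N^2 |Bx|^2, and dividing by N^2
   gives |Bx|^2 <= K |x|^2. The maximum with 0 keeps the square root meaningful. *)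
pose K := Num.max 0 (N ^+ 2 - c ^+ 2 / N ^+ 2).
have NK : opnorm (poly_op p A) <= Num.sqrt K.
  apply: opnorm_le; first exact: sqrtr_ge0.
  move=> x; rewrite -(@ler_pXn2r _ 2)// ?nnegrE ?mulr_ge0 ?nr_ge0 ?sqrtr_ge0//.
  rewrite exprMn sqr_sqrtr ?le_max ?lexx//.
  apply: (@le_trans _ _ ((N ^+ 2 - c ^+ 2 / N ^+ 2) * nr x ^+ 2)); last first.
    by rewrite ler_wpM2r ?sqr_ge0// le_max lexx orbT.
  rewrite mulrBl lerBrDr -lerBrDl mulrAC ler_pdivrMr ?exprn_gt0//.
  have : c ^+ 2 * nr x ^+ 2 <= nr (poly_op ((N ^+ 2)%:P - p * p) A x) ^+ 2.
    by rewrite -exprMn ler_pXn2r ?nnegrE ?mulr_ge0 ?nr_ge0 ?(ltW c0)//.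
  move=> /le_trans; apply.
  rewrite poly_opB// poly_opC poly_opM// nr_sqrB nrZr ripZl -symp ripxx.
  have : nr (poly_op p A (poly_op p A x)) ^+ 2 <= N ^+ 2 * nr (poly_op p A x) ^+ 2.
    by rewrite -exprMn ler_pXn2r ?nnegrE ?mulr_ge0 ?nr_ge0 ?(ltW N0)// opnorm_ub.
  rewrite ger0_norm ?sqr_ge0// [(N ^+ 2 * _) ^+ 2]exprMn.
  move: (nr _ ^+ 2) (nr _ ^+ 2) (nr _ ^+ 2) => X Y Z; lra.
have : K < N ^+ 2.
  by rewrite gt_max exprn_gt0//= ltrBlDr ltrDl divr_gt0 ?exprn_gt0.
rewrite -[ltLHS]sqr_sqrtr ?le_max ?lexx// ltr_pXn2r ?nnegrE ?sqrtr_ge0 ?(ltW N0)//.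
by rewrite ltNge NK.
Qed.

End PolynomialCalculus.

(** * Uniform approximation of powers by Bernstein polynomials *)

Section PowerApproximation.
Variable R : realType.
Implicit Types (s t u v e d : R) (g h : nat -> R).

(** At s in [0, 1] this is the mean of g(k) for k binomial of parameters n and s, unfolded along one
    trial. [g] takes the number of successes, so the division by n is left to the caller. *)
Fixpoint bernstein n g : {poly R} :=
  if n is n'.+1 then 'X * bernstein n' (g \o S) + (1 - 'X) * bernstein n' g
  else (g 0)%:P.

Lemma bernsteinS n g s : (bernstein n.+1 g).[s] =
  s * (bernstein n (g \o S)).[s] + (1 - s) * (bernstein n g).[s].
Proof. by rewrite /= !hornerE. Qed.

Lemma bernstein_le n g h s : 0 <= s <= 1 -> (forall k, g k <= h k) ->
  (bernstein n g).[s] <= (bernstein n h).[s].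
Proof.
move=> s01; elim: n g h => [|n IH] g h gh; first by rewrite /= !hornerC.
case/andP: (s01) => s0 s1; rewrite !bernsteinS.
by rewrite lerD// ler_wpM2l ?subr_ge0// IH// => k; exact: gh.
Qed.

(* Mean and variance of the binomial distribution of parameters [n] and [s]. *)
Lemma bernstein_quadratic n a b c s :
  (bernstein n (fun k => a + b * (k%:R - c) ^+ 2)).[s] =
  a + b * (n%:R * s * (1 - s) + (n%:R * s - c) ^+ 2).
Proof.
elim: n c => [|n IH] c; first by rewrite /= hornerC; ring.
rewrite bernsteinS IH.
have -> : (fun k => a + b * (k%:R - c) ^+ 2) \o S =
    (fun k => a + b * (k%:R - (c - 1)) ^+ 2).
  by apply/funext => k /=; rewrite -natr1; ring.
by rewrite IH -natr1; ring.
Qed.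

(** Dividing by u leaves two numbers p, q of [0, 1] with p + q = 1, and there p <= p^t and q <=
    q^t. *)
Lemma powR_subadd u v t : 0 < t <= 1 -> 0 <= v <= u ->
  u `^ t <= v `^ t + (u - v) `^ t.
Proof.
move=> /andP[t0 t1] /andP[v0 vu].
have [u0|u0] := eqVneq u 0; first by rewrite u0 powR0 ?gt_eqF// addr_ge0 ?powR_ge0.
have {}u0 : 0 < u by rewrite lt0r u0 (le_trans v0).
have un0 : u != 0 by rewrite gt_eqF.
have le_pow (p : R) : 0 <= p <= 1 -> p <= p `^ t.
  move=> /andP[]; rewrite le_eqVlt => /orP[/eqP <-|p0 p1]; first by rewrite powR_ge0.
  by rewrite ger1_powR ?p0.
have p01 : v / u <= (v / u) `^ t.
  by rewrite le_pow// divr_ge0 ?(ltW u0)//= ler_pdivrMr// mul1r.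
have q01 : (u - v) / u <= ((u - v) / u) `^ t.
  by rewrite le_pow// divr_ge0 ?(ltW u0) ?subr_ge0//= ler_pdivrMr// mul1r gerBl.
have -> : v `^ t = (v / u) `^ t * u `^ t.
  by rewrite -powRM ?divr_ge0 ?(ltW u0)// divfK.
have -> : (u - v) `^ t = ((u - v) / u) `^ t * u `^ t.
  by rewrite -powRM ?divr_ge0 ?subr_ge0 ?(ltW u0)// divfK.
rewrite -mulrDl ler_peMl ?powR_ge0//.
apply: le_trans (lerD p01 q01).
by rewrite -mulrDl addrC subrK divff ?gt_eqF.
Qed.

Lemma powR_holder u v t : 0 < t <= 1 -> 0 <= u -> 0 <= v ->
  `|u `^ t - v `^ t| <= `|u - v| `^ t.
Proof.
move=> t01; wlog vu : u v / v <= u => [hw u0 v0|u0 v0].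
  have [vu|/ltW uv] := leP v u; first exact: hw.
  by rewrite distrC (distrC u); exact: hw.
have t0 : 0 <= t by case/andP: t01 => /ltW.
rewrite ger0_norm ?(ger0_norm (x := u - v)) ?subr_ge0//; last first.
  by apply: ge0_ler_powR; rewrite ?nnegrE.
by rewrite lerBlDl powR_subadd// v0.
Qed.

(** A pointwise form of Chebyshev's inequality: it lets the variance control the mean of |k/n -
    s|^t. *)
Lemma powR_le_quadratic t e : 0 < t <= 1 -> 0 < e ->
  exists2 d, 0 < d & forall u, 0 <= u -> u `^ t <= e + d * u ^+ 2.
Proof.
(* Below r the power is at most e. Above r it is at most (u/r)^2: u^t <= 1 up to u = 1, and u^t <= u
   <= u/r beyond, which needs r <= 1. *)
move=> /andP[t0 t1] e0; pose r := Num.min 1 (e `^ t^-1).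
have r0 : 0 < r by rewrite lt_min ltr01 powR_gt0.
have r1 : r <= 1 by rewrite ge_min lexx.
exists (r ^- 2) => [|u u0]; first by rewrite invr_gt0 exprn_gt0.
have [ur|ru] := leP u r.
  apply: (@le_trans _ _ e); last first.
    by rewrite lerDl mulr_ge0 ?sqr_ge0// invr_ge0 sqr_ge0.
  apply: (@le_trans _ _ ((e `^ t^-1) `^ t)).
    apply: (ge0_ler_powR (ltW t0)); rewrite ?nnegrE ?powR_ge0//.
    by rewrite (le_trans ur)// ge_min lexx orbT.
  by rewrite -powRrM mulVf ?gt_eqF// powRr1// ltW.
apply: (@le_trans _ _ (r ^- 2 * u ^+ 2)); last by rewrite lerDr ltW.
have ur1 : 1 <= (u / r) ^+ 2 by rewrite exprn_ege1// ler_pdivlMr// mul1r ltW.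
rewrite mulrC -expr_div_n.
have [u1|/ltW u1] := leP u 1.
  apply: le_trans ur1; have := ge0_ler_powR (ltW t0) _ _ u1.
  by rewrite powR1; apply; rewrite nnegrE.
apply: (@le_trans _ _ u); first by rewrite ler1_powR.
apply: (@le_trans _ _ (u / r)).
  by rewrite ler_peMr// invf_ge1.
by rewrite expr2 ler_peMr ?divr_ge0 ?(ltW r0)// ler_pdivlMr// mul1r ltW.
Qed.

(** By Hölder continuity, (k/n)^t lies between two quadratics in k centred at n s. Bernstein
    operators preserve order and are explicit on quadratics; the variance contributes at most d/n,
    which the choice of N makes at most e/2. *)
Lemma powR_approx01 t e : 0 < t <= 1 -> 0 < e ->
  exists p : {poly R}, forall s, 0 <= s <= 1 -> `|p.[s] - s `^ t| <= e.
Proof.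
move=> t01 e0; have e2 : 0 < e / 2 by rewrite divr_gt0.
have [d d0 dP] := powR_le_quadratic t01 e2.
have [N /(_ N (leqnn _)) Ne] := inv_natS_le (divr_gt0 e2 d0).
pose n := N.+1%:R : R; have n0 : 0 < n by rewrite ltr0n.
exists (bernstein N.+1 (fun k => (k%:R / n) `^ t)) => s s01; case/andP: (s01) => s0 s1.
have holder k : `|(k%:R / n) `^ t - s `^ t| <= e / 2 + d / n ^+ 2 * (k%:R - n * s) ^+ 2.
  apply: le_trans (powR_holder t01 _ s0) _; first by rewrite divr_ge0// ltW.
  apply: le_trans (dP _ (normr_ge0 _)) _.
  rewrite lerD2l real_normK ?num_real// -mulrA ler_wpM2l ?(ltW d0)//.
  by rewrite le_eqVlt; apply/orP; left; apply/eqP; field; rewrite gt_eqF.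
have var : d / n ^+ 2 * (N.+1%:R * s * (1 - s) + (N.+1%:R * s - n * s) ^+ 2) <= e / 2.
  rewrite subrr expr0n addr0 -/n.
  have -> : d / n ^+ 2 * (n * s * (1 - s)) = s * (1 - s) * (d / n) by field; rewrite gt_eqF.
  apply: (@le_trans _ _ (d / n)).
    rewrite ler_piMl ?divr_ge0 ?(ltW d0) ?(ltW n0)//.
    by rewrite mulr_ile1 ?subr_ge0// gerBl.
  by move: Ne; rewrite ler_pdivlMr// mulrC.
have lower := @bernstein_le N.+1
  (fun k => (s `^ t - e / 2) + - (d / n ^+ 2) * (k%:R - n * s) ^+ 2)
  (fun k => (k%:R / n) `^ t) s s01.
have upper := @bernstein_le N.+1 (fun k => (k%:R / n) `^ t)
  (fun k => (s `^ t + e / 2) + (d / n ^+ 2) * (k%:R - n * s) ^+ 2) s s01.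
rewrite !bernstein_quadratic in lower upper.
move: (d / n ^+ 2) holder var lower upper => D holder var lower upper.
rewrite ler_norml; apply/andP; split.
  rewrite lerBrDr; apply: le_trans (lower _); first by move: var; lra.
  by move=> k; have := holder k; rewrite ler_norml => /andP[+ _]; lra.
rewrite lerBlDr; apply: le_trans (upper _) _; last by move: var; lra.
by move=> k; have := holder k; rewrite ler_norml => /andP[_ +]; lra.
Qed.

Lemma powR_approx t e (a : R) : 0 <= a -> 0 < t <= 1 -> 0 < e ->
  exists p : {poly R}, forall s, 0 <= s <= a -> `|p.[s] - s `^ t| <= e.
Proof.
move=> a0 t01 e0; have b0 : 0 < a + 1 by rewrite ltr_wpDl.
have [p pP] := powR_approx01 t01 (divr_gt0 e0 (powR_gt0 t b0)).
(* Rescaling by a + 1 rather than a, as a may be 0. *)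
exists (((a + 1) `^ t) *: (p \Po ((a + 1)^-1 *: 'X))) => s /andP[s0 sa].
rewrite hornerZ horner_comp hornerZ hornerX [_^-1 * s]mulrC.
have -> : s `^ t = (a + 1) `^ t * (s / (a + 1)) `^ t.
  by rewrite -powRM ?divr_ge0 ?(ltW b0)// mulrC divfK// gt_eqF.
rewrite -mulrBr normrM ger0_norm ?powR_ge0//.
rewrite -ler_pdivlMl ?powR_gt0// [leRHS]mulrC pP// divr_ge0 ?(ltW b0)//=.
by rewrite ler_pdivrMr// mul1r (le_trans sa)// lerDl.
Qed.

End PowerApproximation.

(** * The continuous functional calculus of a positive operator *)

Section ContinuousCalculus.
Local Open Scope complex_scope.
Variables (R : realType) (H : hilbertType R) (A : H -> H).
Hypothesis pA : positive_op A.
Implicit Types (x y z : H) (s t a c e d M N : R) (B C D : H -> H) (f g : R -> R).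

Local Notation nr := (@realnorm R H).
Local Notation I := (fun s : R => 0 <= s <= opnorm A).

Let bA : bounded_operator A. Proof. by case: pA. Qed.
Let linA : linear A. Proof. exact: bounded_lin bA. Qed.

(** Passing through the approximants p and q costs 4e: one e for each operator, one for each
    function. Uniqueness and norm bounds are special cases. *)
Lemma cfc_dist f g B C d : is_cfc f A B -> is_cfc g A C ->
  (forall s, I s -> `|f s - g s| <= d) -> forall x, nr (B x - C x) <= d * nr x.
Proof.
move=> fB gC fg x; apply: (@le_eps _ (4 * nr x)) => e e0.
have [p [pf pB]] := fB _ e0; have [q [qg qC]] := gC _ e0.
have pq : bounded_by (poly_op (p - q) A) (d + 2 * e).
  apply: poly_op_bound => // s sI; rewrite hornerD hornerN.
  have -> : p.[s] - q.[s] = (p.[s] - f s) + (f s - g s) + (g s - q.[s]) by ring.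
  rewrite (le_trans (ler_normD _ _))//.
  have -> : d + 2 * e = e + d + e by ring.
  rewrite lerD//; last by rewrite distrC qg.
  by rewrite (le_trans (ler_normD _ _))// lerD// ?pf ?fg.
have {}pB := pB x; have {}qC := qC x; have {}pq := pq x.
rewrite norm_leE in pB; rewrite norm_leE in qC; rewrite poly_opB// in pq.
have h1 := nrB (B x) (C x) (poly_op p A x).
have h2 := nrB (poly_op p A x) (C x) (poly_op q A x).
by rewrite nrC in pB; move: pB qC pq h1 h2; lra.
Qed.

Lemma cfc_eq f g B C : is_cfc f A B -> is_cfc g A C ->
  (forall s, I s -> f s = g s) -> B = C.
Proof.
move=> fB gC fg; apply/funext => x; apply/subr0_eq/nr_eq0/le_anti.
rewrite nr_ge0 andbT -(mul0r (nr x)); apply: (cfc_dist fB gC) => s sI.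
by rewrite fg// subrr normr0.
Qed.

Lemma cfc_poly (p : {poly R}) : is_cfc (horner p) A (poly_op p A).
Proof.
move=> e e0; exists p; split => [s _|x]; first by rewrite subrr normr0 ltW.
by rewrite subrr normr0 mulr_ge0// ler0c ltW.
Qed.

Lemma cfc_cst c : is_cfc (fun=> c) A (fun x => c%:C *: x).
Proof.
have := cfc_poly c%:P; congr is_cfc; last by apply/funext => x; rewrite poly_opC.
by apply/funext => s; rewrite hornerC.
Qed.

Lemma cfc_id : is_cfc id A A.
Proof.
have := cfc_poly 'X; congr is_cfc; last by apply/funext => x; rewrite poly_opX.
by apply/funext => s; rewrite hornerX.
Qed.

Lemma cfc_bounded_by f B M : is_cfc f A B -> (forall s, I s -> `|f s| <= M) ->
  bounded_by B M.
Proof.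
move=> fB fM x; have := cfc_dist fB (cfc_cst 0) (d := M).
move=> /(_ _ x); rewrite scale0r subr0; apply => s sI.
by rewrite subr0 fM.
Qed.

(** 0 <= f <= M gives |f - M| <= M, hence |Bx - Mx| <= M |x|, and then <Bx, x> >= M |x|^2 - M
    |x|^2. *)
Lemma cfc_ge0 f B M : is_cfc f A B -> (forall s, I s -> 0 <= f s <= M) ->
  forall x, 0 <= rip (B x) x.
Proof.
move=> fB fM x; have := cfc_dist fB (cfc_cst M) (d := M).
move=> /(_ _ x) h.
have {}h : nr (B x - M%:C *: x) <= M * nr x.
  by apply: h => s /fM /andP[f0 fsM]; rewrite distrC ger0_norm ?subr_ge0// gerBl.
have := rip_norm_le (B x - M%:C *: x) x.
rewrite ripBl ripZl ripxx ler_norml => /andP[+ _].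
have := ler_wpM2r (nr_ge0 x) h; rewrite -mulrA -expr2.
by move: (rip _ _) (nr _ * _) (nr x ^+ 2) => p q r; lra.
Qed.

Lemma cfc_comp f g B C M N : is_cfc f A B -> is_cfc g A C ->
  (forall s, I s -> `|f s| <= M) -> (forall s, I s -> `|g s| <= N) ->
  is_cfc (fun s => f s * g s) A (B \o C).
Proof.
move=> fB gC fM gN e e0.
have I0 : I 0 by rewrite lexx opnorm_ge0.
have M0 : 0 <= M by apply: le_trans (fM 0 I0).
have N0 : 0 <= N by apply: le_trans (gN 0 I0).
have K0 : 0 < M + N + 1 by rewrite ltr_wpDl// addr_ge0.
(* The error is at most (M + d) d + d N; with d <= 1 this is at most d (M + N + 1). *)
pose d := Num.min 1 (e / (M + N + 1)).
have d0 : 0 < d by rewrite lt_min ltr01 divr_gt0.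
have de : (M + d) * d + d * N <= e.
  have : d * (M + N + 1) <= e by rewrite -ler_pdivlMr// ge_min lexx orbT.
  have : d * d <= d by rewrite ler_piMr ?(ltW d0)// ge_min lexx.
  nra.
have [p [pf pB]] := fB _ d0; have [q [qg qC]] := gC _ d0.
have pM s : I s -> `|p.[s]| <= M + d.
  move=> sI; rewrite -(subrK (f s) p.[s]) (le_trans (ler_normD _ _))// addrC.
  by rewrite lerD ?pf ?fM.
exists (p * q); split => [s sI|x].
  have -> : (p * q).[s] - f s * g s = p.[s] * (q.[s] - g s) + (p.[s] - f s) * g s.
    by rewrite hornerM; ring.
  rewrite (le_trans (ler_normD _ _))// !normrM (le_trans _ de)//.
  by rewrite lerD// ler_pM// ?pM ?qg ?pf ?gN.
rewrite norm_leE poly_opM//=.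
apply: le_trans (nrB _ _ (poly_op p A (C x))) _.
apply: le_trans (ler_wpM2r (nr_ge0 x) de); rewrite mulrDl lerD//.
  have linp := poly_op_lin p linA; rewrite -linB// -mulrA.
  apply: le_trans (poly_op_bound pA pM _) _; rewrite ler_wpM2l ?addr_ge0 ?(ltW d0)//.
  by rewrite -norm_leE qC.
have := pB (C x); rewrite norm_leE => /le_trans; apply.
by rewrite -mulrA ler_wpM2l ?(ltW d0)// (cfc_bounded_by gC gN).
Qed.

Lemma cfc_lin f B : is_cfc f A B -> linear B.
Proof.
move=> fB k x y; apply/subr0_eq/nr_eq0/le_anti; rewrite nr_ge0 andbT.
apply: (@le_eps _ (nr (k *: x + y) + (complex.Re `|k| * nr x + nr y))) => e e0.
have [p [_ pB]] := fB _ e0; have linp := poly_op_lin p linA.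
have pBr z : nr (poly_op p A z - B z) <= e * nr z.
  by rewrite -norm_leE pB.
rewrite add0r mulrDl.
apply: le_trans (nrB _ _ (poly_op p A (k *: x + y))) _; rewrite lerD//.
  by rewrite nrC mulrC pBr.
rewrite linp opprD addrACA -scalerBr (le_trans (nrD _ _))// nrZ mulrDl lerD//.
  by rewrite -mulrA ler_wpM2l ?[_ * e]mulrC// -ler0c RRe_real ?normr_real.
by rewrite mulrC.
Qed.

Lemma cfc_sym f B : is_cfc f A B -> symmetric_op B.
Proof.
move=> fB x y; apply/subr0_eq/eqP; rewrite -normr_eq0; apply/eqP/le_anti.
rewrite normr_ge0 andbT; apply: (@le_eps _ (2 * (nr x * nr y))) => e e0.
have [p [_ pB]] := fB _ e0.
have symp : symmetric_op (poly_op p A) by case: pA => _ symA _; exact: poly_op_sym.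
have pBr z : nr (poly_op p A z - B z) <= e * nr z.
  by rewrite -norm_leE pB.
have -> : rip (B x) y - rip x (B y) =
    rip x (poly_op p A y - B y) - rip (poly_op p A x - B x) y.
  by rewrite ripBl ripBr symp; ring.
have h1 := le_trans (rip_norm_le _ _) (ler_wpM2l (nr_ge0 x) (pBr y)).
have h2 := le_trans (rip_norm_le _ _) (ler_wpM2r (nr_ge0 y) (pBr x)).
rewrite (le_trans (ler_normB _ _))//; move: h1 h2; lra.
Qed.

Lemma cfc_positive f B M : is_cfc f A B -> (forall s, I s -> 0 <= f s <= M) ->
  positive_op B.
Proof.
move=> fB fM; split; [|exact: cfc_sym fB|exact: cfc_ge0 fB fM].
apply: bounded_byP (cfc_lin fB) (cfc_bounded_by (M := M) fB _) => s /fM /andP[f0 fsM].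
by rewrite ger0_norm.
Qed.

(** [poly_op_bound] turns uniformly Cauchy polynomials into operators Cauchy in norm; the pointwise
    limit inherits the uniform rate. *)
Lemma cfc_ex f :
  (forall e, 0 < e -> exists p : {poly R}, forall s, I s -> `|p.[s] - f s| <= e) ->
  exists B, is_cfc f A B.
Proof.
move=> fP.
have /choice[p pP] : forall n : nat, exists p : {poly R},
    forall s, I s -> `|p.[s] - f s| <= n.+1%:R^-1.
  by move=> n; apply: fP; rewrite invr_gt0 ltr0n.
have pC n m x : nr (poly_op (p n) A x - poly_op (p m) A x) <=
    (n.+1%:R^-1 + m.+1%:R^-1) * nr x.
  rewrite -poly_opB//; apply: poly_op_bound => // s sI.
  rewrite hornerD hornerN -(subrK (f s) (p n).[s]) -addrA.
  by rewrite (le_trans (ler_normD _ _))// lerD ?pP// distrC pP.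
have tail x (N n m : nat) : (N <= n)%N -> (N <= m)%N ->
    nr (poly_op (p n) A x - poly_op (p m) A x) <= (2 * N.+1%:R^-1) * nr x.
  move=> Nn Nm; apply: le_trans (pC _ _ _) _; rewrite ler_wpM2r ?nr_ge0//.
  by rewrite mulr2n mulrDl mul1r lerD// lef_pV2 ?posrE ?ltr0n// ler_nat ltnS.
have /choice[B BP] : forall x, exists l, nlim (fun n => poly_op (p n) A x) l.
  move=> x; apply: nlim_ex => e e0.
  have K0 : 0 < 2 * (nr x + 1) by rewrite mulr_gt0// ltr_wpDl// nr_ge0.
  have [N /(_ N (leqnn _)) Ne] := inv_natS_le (divr_gt0 e0 K0).
  exists N => n m Nn Nm; apply: le_trans (tail _ _ _ _ Nn Nm) _.
  apply: (@le_trans _ _ (N.+1%:R^-1 * (2 * (nr x + 1)))).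
    rewrite -mulrA mulrCA ler_wpM2l ?invr_ge0//.
    by rewrite ler_wpM2l// lerDl.
  by rewrite -ler_pdivlMr.
exists B => e e0.
have [N /(_ N (leqnn _)) Ne] := inv_natS_le (divr_gt0 e0 (@ltr0n R 2)).
exists (p N); split => [s /pP/le_trans|x]; first apply.
  by rewrite (le_trans Ne)// ler_pdivrMr// ler_peMr ?(ltW e0)// ler1n.
rewrite norm_leE.
apply: (@le_eps _ 1) => d d0; have [M uM] := BP x _ d0.
apply: le_trans (nrB _ _ (poly_op (p (maxn N M)) A x)) _.
rewrite mul1r lerD// ?uM ?leq_maxr//.
apply: le_trans (tail _ N _ _ _ _) _; rewrite ?leq_maxl//.
by rewrite ler_wpM2r ?nr_ge0// mulrC -ler_pdivlMr.
Qed.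

Lemma oppowP t : 0 < t <= 1 -> is_cfc (fun s => s `^ t) A (oppow A t).
Proof.
move=> t01; have [B] := cfc_ex (fun e => @powR_approx _ t e _ (opnorm_ge0 bA) t01).
by move=> AB; apply: (@xgetI _ _ _ B).
Qed.

End ContinuousCalculus.

(** * The orthogonal projection onto the kernel *)

Section KernelProjection.
Local Open Scope complex_scope.
Variables (R : realType) (H : hilbertType R) (A : H -> H).
Hypothesis pA : positive_op A.
Implicit Types (x y z : H) (s e : R).

Local Notation nr := (@realnorm R H).

Let bA : bounded_operator A. Proof. by case: pA. Qed.
Let linA : linear A. Proof. exact: bounded_lin bA. Qed.
Let symA : symmetric_op A. Proof. by case: pA. Qed.

(** Keeps 1 - c s in [0, 1] on the interval [0, ||A||]; the added 1 keeps c nonzero when A = 0. *)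
Let c : R := (opnorm A + 1)^-1.

(* On the spectrum, [damping n] tends to the indicator function of [0]. *)
Definition damping n : {poly R} := (1 - c *: 'X) ^+ n.

(** A geometric sum, approximating 1/s for s > 0. *)
Definition damping_quotient n : {poly R} := c *: \sum_(i < n) damping i.

Lemma damping_quotientP n : damping_quotient n * 'X = 1 - damping n.
Proof.
have E (p : {poly R}) : 1 - p ^+ n = (1 - p) * \sum_(i < n) p ^+ i.
  by rewrite -opprB subrX1 -mulNr opprB.
rewrite /damping_quotient /damping E subKr.
by rewrite -!scalerAl mulrC.
Qed.

Lemma damping_itv s : 0 <= s <= opnorm A -> exists2 v, 0 <= v <= 1 &
  forall n, (damping n).[s] = v ^+ n.
Proof.
move=> /andP[s0 sA]; have c1 : 0 < opnorm A + 1 by rewrite ltr_wpDl// (le_trans s0).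
exists (1 - c * s); last by move=> n; rewrite horner_exp !hornerE.
rewrite subr_ge0 gerBl mulr_ge0 ?invr_ge0 ?(ltW c1)// andbT.
by rewrite /c mulrC ler_pdivrMr// mul1r (le_trans sA)// lerDl.
Qed.

(** On the interval v^n - v^m lies in [0, 1], so its square is at most itself. Strong convergence
    thus reduces to that of a decreasing nonnegative real sequence. *)
Lemma damping_sub x n m : (n <= m)%N ->
  nr (poly_op (damping n) A x - poly_op (damping m) A x) ^+ 2 <=
  rip (poly_op (damping n) A x) x - rip (poly_op (damping m) A x) x.
Proof.
move=> nm; set p := damping n - damping m.
rewrite -poly_opB// -ripBl -poly_opB// -/p -ripxx.
rewrite -(poly_op_sym p linA symA) -poly_opM// -subr_ge0 -ripBl -poly_opB//.
apply: (cfc_ge0 pA (cfc_poly A (p - p * p)) (M := 1)) => s sI.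
have [v /andP[v0 v1] vE] := damping_itv sI.
have pE : p.[s] = v ^+ n - v ^+ m by rewrite /p hornerD hornerN !vE.
rewrite hornerD hornerN hornerM pE.
have vn0 : 0 <= v ^+ n <= 1 by rewrite exprn_ge0//= exprn_ile1.
have vm0 : 0 <= v ^+ m by rewrite exprn_ge0.
have vnm : v ^+ m <= v ^+ n by exact: ler_wiXn2l.
move: vn0 vm0 vnm; move: (v ^+ n) (v ^+ m) => a b; nra.
Qed.

Lemma damping_cauchy x e : 0 < e -> exists N, forall n m, (N <= n)%N -> (N <= m)%N ->
  nr (poly_op (damping n) A x - poly_op (damping m) A x) <= e.
Proof.
move=> e0; pose phi n := rip (poly_op (damping n) A x) x.
have phi0 n : 0 <= phi n.
  apply: (cfc_ge0 pA (cfc_poly A (damping n)) (M := 1)) => s sI.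
  by have [v /andP[v0 v1] ->] := damping_itv sI; rewrite exprn_ge0//= exprn_ile1.
have phi_dec n m : (n <= m)%N -> phi m <= phi n.
  by move=> nm; rewrite -subr_ge0; apply: le_trans (damping_sub x nm); exact: sqr_ge0.
have hasphi : has_inf (range phi).
  by split; [exists (phi 0%N), 0%N|exists 0 => _ [n _ <-]].
have [_ [N _ <-] phiN] := inf_adherent (exprn_gt0 2 e0) hasphi.
have infphi n : inf (range phi) <= phi n by apply: ge_inf; [case: hasphi|exists n].
exists N.
suff main n m : (N <= n)%N -> (N <= m)%N -> (n <= m)%N ->
    nr (poly_op (damping n) A x - poly_op (damping m) A x) <= e.
  move=> n m Nn Nm; case: (leqP n m) => [|/ltnW] nm; first exact: main.
  by rewrite nrC; exact: main.
move=> Nn Nm nm; rewrite -(@ler_pXn2r _ 2)// ?nnegrE ?nr_ge0 ?(ltW e0)//.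
apply: le_trans (damping_sub x nm) _; rewrite -/(phi n) -/(phi m).
have := phi_dec _ _ Nn; have := infphi m; move: phiN; lra.
Qed.

Definition kernel_proj x : H :=
  xget 0 [set l | nlim (fun n => poly_op (damping n) A x) l].

Lemma kernel_projP x : nlim (fun n => poly_op (damping n) A x) (kernel_proj x).
Proof.
by have [l] := nlim_ex (damping_cauchy x); exact: (@xgetI _ _ _ l).
Qed.

Lemma kernel_projK x : A (kernel_proj x) = 0.
Proof.
have c0 : c != 0 by rewrite invr_neq0// gt_eqF// ltr_wpDl// opnorm_ge0.
have [M _ AM] := bounded_ex bA.
(* c A times the n-th approximant is the difference of two consecutive ones, so it tends to 0. *)
have step n : c%:C *: A (poly_op (damping n) A x) =
    poly_op (damping n) A x - poly_op (damping n.+1) A x.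
  rewrite /damping exprS mulrBl mul1r poly_opB// subKr.
  by rewrite -mul_polyC -mulrA poly_opM// poly_opM// poly_opX poly_opC.
suff : c%:C *: A (kernel_proj x) = 0.
  by move/(congr1 nr); rewrite nrZr nr0 => /eqP; rewrite mulf_eq0 normr_eq0 (negPf c0) => /eqP/nr_eq0.
apply/nr_eq0/le_anti; rewrite nr_ge0 andbT.
have lim := nlim_bounded (lin_scale c%:C linA) (bounded_by_scale c%:C AM) (kernel_projP x).
apply: (@le_eps _ 2) => e e0; have [N uN] := lim _ e0; have [N' dN] := damping_cauchy x e0.
pose n := maxn N N'.
rewrite -[c%:C *: _]subr0; apply: le_trans (nrB _ _ ((c%:C *: A (poly_op (damping n) A x)))) _.
have := uN n (leq_maxl _ _); rewrite /= nrC => h1.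
have := dN n n.+1 (leq_maxr _ _) (leqW (leq_maxr _ _)); rewrite -step => h2.
by rewrite subr0; move: h1 h2; lra.
Qed.

Lemma damping_fix n y : A y = 0 -> poly_op (damping n) A y = y.
Proof.
move=> Ay; elim: n => [|n IH]; first by rewrite /damping expr0 poly_op1.
rewrite /damping exprSr -/(damping n) poly_opM// poly_opB// poly_op1.
by rewrite -mul_polyC poly_opM// poly_opX Ay poly_opC scaler0 subr0.
Qed.

Lemma kernel_proj_fix y : A y = 0 -> kernel_proj y = y.
Proof.
move=> Ay; apply: nlim_uniq (kernel_projP y) _.
have -> : (fun n => poly_op (damping n) A y) = fun=> y.
  by apply/funext => n; exact: damping_fix.
exact: nlim_const.
Qed.

Lemma kernel_proj_lin : linear kernel_proj.
Proof.
move=> k x y; apply: nlim_uniq (kernel_projP _) _.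
have -> : (fun n => poly_op (damping n) A (k *: x + y)) =
    fun n => k *: poly_op (damping n) A x + poly_op (damping n) A y.
  by apply/funext => n; rewrite poly_op_lin.
exact: nlim_lin (kernel_projP _) (kernel_projP _).
Qed.

(** Makes [x - kernel_proj x] orthogonal to the kernel: the projection is the orthogonal one. *)
Lemma kernel_proj_rip x y : A y = 0 -> rip (kernel_proj x) y = rip x y.
Proof.
move=> Ay; apply: nlim_rip_eq (kernel_projP x) _ => n.
by rewrite (poly_op_sym _ linA symA) damping_fix.
Qed.

(** The range of A is dense in the orthogonal complement of its kernel. Both the polar factor and
    the strong continuity of powers are obtained on that range and extended by this limit. *)
Lemma kernel_proj_lim x :
  nlim (fun n => A (poly_op (damping_quotient n) A x)) (x - kernel_proj x).
Proof.
have -> : (fun n => A (poly_op (damping_quotient n) A x)) =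
    fun n => (-1) *: poly_op (damping n) A x + x.
  apply/funext => n; rewrite poly_opE -cpoly_op_comm// -poly_opE -poly_opMX.
  by rewrite damping_quotientP poly_opB// poly_op1 scaleN1r addrC.
rewrite addrC -(scaleN1r (kernel_proj x)).
exact: nlim_lin (kernel_projP x) (nlim_const x).
Qed.

Lemma nr_sub_kernel_proj x : nr (x - kernel_proj x) <= nr x.
Proof.
rewrite -(@ler_pXn2r _ 2)// ?nnegrE ?nr_ge0// nr_sqrB.
rewrite -(kernel_proj_rip x (kernel_projK x)) ripxx.
have := sqr_ge0 (nr (kernel_proj x)); lra.
Qed.

End KernelProjection.

(** * The absolute value and the polar decomposition *)

Section PolarDecomposition.
Local Open Scope complex_scope.
Variables (R : realType) (H : hilbertType R) (T : H -> H).
Hypothesis bT : bounded_operator T.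
Implicit Types (x y z : H) (s t u e : R).

Local Notation nr := (@realnorm R H).
Local Notation K := (kernel_proj (absop T)).

Let linT : linear T. Proof. exact: bounded_lin bT. Qed.

Lemma adjoint_comp_positive : positive_op (adjoint T \o T).
Proof.
split=> [|x y|x] /=; first exact: bounded_comp (adjoint_bounded bT) bT.
  by rewrite adjoint_ripC// adjoint_rip.
by rewrite adjoint_ripC// ripxx sqr_ge0.
Qed.

Let half01 : 0 < (2^-1 : R) <= 1.
Proof. by apply/andP; split; lra. Qed.

Lemma powR_ge0_le t s (a : R) : 0 <= t -> 0 <= s <= a -> 0 <= s `^ t <= a `^ t.
Proof.
move=> t0 /andP[s0 sa]; rewrite powR_ge0; apply: (ge0_ler_powR t0); rewrite ?nnegrE//.
exact: le_trans sa.
Qed.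

Lemma absop_positive : positive_op (absop T).
Proof.
apply: (cfc_positive adjoint_comp_positive (oppowP adjoint_comp_positive half01)) => s.
by apply: powR_ge0_le; rewrite invr_ge0.
Qed.

Let pQ := absop_positive.
Let bQ : bounded_operator (absop T). Proof. by case: pQ. Qed.
Let linQ : linear (absop T). Proof. exact: bounded_lin bQ. Qed.
Let symQ : symmetric_op (absop T). Proof. by case: pQ. Qed.

Lemma absop_sqr x : absop T (absop T x) = adjoint T (T x).
Proof.
have pTT := adjoint_comp_positive.
have bnd s : 0 <= s <= opnorm (adjoint T \o T) ->
    `|s `^ 2^-1| <= opnorm (adjoint T \o T) `^ 2^-1.
  move=> /(@powR_ge0_le 2^-1)-/(_ _)/andP[]; first by rewrite invr_ge0.
  by move=> s0; rewrite ger0_norm.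
have cQ := oppowP pTT half01.
suff E : absop T \o absop T = adjoint T \o T by exact: (congr1 (@^~ x) E).
apply: (cfc_eq pTT (cfc_comp pTT cQ cQ bnd bnd) (cfc_id _)) => s /andP[s0 _].
by rewrite powR12_sqrt// -expr2 sqr_sqrtr.
Qed.

Lemma nr_absop x : nr (absop T x) = nr (T x).
Proof.
apply/eqP; rewrite -(@eqrXn2 _ 2)// ?nr_ge0//; apply/eqP.
by rewrite -!ripxx symQ absop_sqr -adjoint_rip.
Qed.

Lemma absop_eq0 x : absop T x = 0 <-> T x = 0.
Proof.
by split=> x0; apply: nr_eq0; [rewrite -nr_absop|rewrite nr_absop]; rewrite x0 nr0.
Qed.

Lemma opnorm_absop : opnorm (absop T) <= opnorm T.
Proof.
by apply: opnorm_le; rewrite ?opnorm_ge0// => x; rewrite nr_absop opnorm_ub.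
Qed.

Lemma T_kernel_proj x : T (K x) = 0.
Proof. exact/absop_eq0/kernel_projK. Qed.

Lemma nlim_nr_eq (u v : nat -> H) l m : nlim u l -> nlim v m ->
  (forall n, nr (u n) = nr (v n)) -> nr l = nr m.
Proof.
suff main (u' v' : nat -> H) l' m' : nlim u' l' -> nlim v' m' ->
    (forall n, nr (u' n) = nr (v' n)) -> nr l' <= nr m'.
  by move=> ul vm uv; apply/le_anti/andP; split; [exact: main uv|apply: main vm ul _ => n].
move=> ul vm uv; apply: (@le_eps _ 2) => e e0.
have [N uN] := ul _ e0; have [M vM] := vm _ e0.
have {uN} := uN _ (leq_maxl N M); have {vM} := vM _ (leq_maxr N M).
move: (maxn N M) => n vn un.
have h1 := nr_le l' (u' n); have h2 := nr_le (v' n) m'.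
by rewrite nrC in un; move: un vn h1 h2; rewrite uv; lra.
Qed.

(* [U] is the strong limit of [T q_n(|T|)], where the polynomials [q_n] satisfy
   [s q_n(s) -> 1] for [s > 0] and [T q_n(|T|)], [|T| q_n(|T|)] have equal norms. *)
Lemma polar_ex : exists U, is_polar T U.
Proof.
pose q n x := poly_op (damping_quotient (absop T) n) (absop T) x.
have linq n : linear (q n) by exact: poly_op_lin.
have nrTq n x : nr (T (q n x)) = nr (absop T (q n x)) by rewrite nr_absop.
have qlim x : nlim (fun n => absop T (q n x)) (x - K x) := kernel_proj_lim pQ x.
have /choice[U UP] : forall x, exists l, nlim (fun n => T (q n x)) l.
  move=> x; apply: nlim_ex => e e0.
  have [N uN] := qlim x _ (divr_gt0 e0 (@ltr0n R 2)).
  exists N => n m Nn Nm; rewrite -linB// -nr_absop linB//.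
  apply: le_trans (nrB _ _ (x - K x)) _.
  by rewrite [leRHS]splitr lerD ?uN// nrC uN.
have nrU x : nr (U x) = nr (x - K x) by exact: nlim_nr_eq (UP x) (qlim x) _.
have linU : linear U.
  move=> k x y; apply: nlim_uniq (UP _) _.
  have -> : (fun n => T (q n (k *: x + y))) = fun n => k *: T (q n x) + T (q n y).
    by apply/funext => n; rewrite linq linT.
  exact: nlim_lin.
have UQ x : U (absop T x) = T x.
  apply: nlim_uniq (UP _) _.
  have -> : (fun n => T (q n (absop T x))) = T \o (fun n => absop T (q n x)).
    by apply/funext => n; rewrite /= /q !poly_opE cpoly_op_comm.
  have [M _ TM] := bounded_ex bT.
  by have := nlim_bounded linT TM (qlim x); rewrite linB// T_kernel_proj subr0.
have kerU x : U x = 0 <-> T x = 0.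
  split=> [/(congr1 nr)|Tx].
    by rewrite nr0 nrU => /nr_eq0/subr0_eq ->; rewrite T_kernel_proj.
  by apply: nr_eq0; rewrite nrU (kernel_proj_fix pQ) ?subrr ?nr0//; exact/absop_eq0.
exists U; split; last exact: kerU; last by apply/funext => x /=; rewrite UQ.
split.
  apply: (@bounded_byP _ _ _ 1) => // x; rewrite nrU mul1r.
  exact: nr_sub_kernel_proj.
(* [K x] is in the kernel of U, so |Kx|^2 = <x, Kx> = 0. *)
move=> x xker; rewrite !normE nrU; suff -> : K x = 0 by rewrite subr0.
have := kernel_proj_rip pQ x (kernel_projK pQ x).
rewrite {2}/rip xker; last exact/kerU/T_kernel_proj.
by rewrite ripxx => /eqP; rewrite expf_eq0 => /eqP/nr_eq0.
Qed.

Local Notation U := (polar T).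

Lemma polarP : is_polar T U.
Proof. by have [U0] := polar_ex; exact: (@xgetI _ _ _ U0). Qed.

Lemma polar_bounded : bounded_operator U.
Proof. by case: polarP => -[]. Qed.

Let linU : linear U. Proof. exact: bounded_lin polar_bounded. Qed.

Lemma polar_absop x : U (absop T x) = T x.
Proof. by have [_ /(congr1 (@^~ x))/esym] := polarP. Qed.

Lemma polar_eq0 x : T x = 0 -> U x = 0.
Proof. by case: polarP => _ _ h /h. Qed.

(** [polar T] is a chosen witness, so this is derived from [is_polar] and not from the limit built
    in [polar_ex]: U kills Kx and is isometric on x - Kx. *)
Lemma nr_polar x : nr (U x) = nr (x - K x).
Proof.
have -> : U x = U (x - K x) by rewrite linB// (polar_eq0 (T_kernel_proj x)) subr0.
apply: (@complexI R); rewrite -!normE; case: polarP => -[_ isoU] _ kerU.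
apply: isoU => y /kerU/absop_eq0 Qy.
have rip0 z : absop T z = 0 -> rip (x - K x) z = 0.
  by move=> Qz; rewrite ripBl (kernel_proj_rip pQ)// subrr.
(* [rip] sees only real parts; complex orthogonality to y also needs iy. *)
have Qiy : absop T ('i *: y) = 0 by rewrite (linZ _ _ linQ) Qy scaler0.
apply/eqP; rewrite eq_complex rip_i (rip0 _ Qiy) eqxx andbT.
by rewrite -/(rip _ _) rip0.
Qed.

Lemma polar_contraction : bounded_by U 1.
Proof. by move=> x; rewrite nr_polar mul1r nr_sub_kernel_proj. Qed.

(** Polarising [nr_polar] turns U^* U, by which |T|^0 is defined, into a projection that the
    calculus of |T| can handle. *)
Lemma adjoint_polar x : adjoint U (U x) = x - K x.
Proof.
have linK := kernel_proj_lin pQ.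
apply: rip_eq => y; rewrite adjoint_ripC; last exact: polar_bounded.
have polarize (a b : H) : 4 * rip a b = nr (a + b) ^+ 2 - nr (a - b) ^+ 2.
  by rewrite (nr_sqrD a b) (nr_sqrB a b); ring.
have : 4 * rip (U x) (U y) = 4 * rip (x - K x) (y - K y).
  rewrite !polarize -(linD _ _ linU) -(linB _ _ linU) !nr_polar.
  rewrite (linD _ _ linK) (linB _ _ linK).
  by congr (nr _ ^+ 2 - nr _ ^+ 2); rewrite !opprD ?opprK !addrA; congr (_ + _); rewrite addrAC.
rewrite [in RHS]ripBr [rip _ (K y)]ripBl.
rewrite (kernel_proj_rip pQ _ (kernel_projK pQ y)) subrr subr0.
by move=> /mulfI; apply.
Qed.

End PolarDecomposition.

(** The factor s absorbs the logarithmic singularity at 0. With h = t - u >= 0: for s <= 1, 1 - s^h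
    <= -h ln s <= h/s, giving the bound h; for s >= 1, s^h - 1 <= s^h h ln s <= h s^2, giving h s^4,
    whence the fourth power. *)
Lemma powR_lipschitz (R : realType) (a s t u : R) : 0 <= s <= a ->
  0 <= t <= 1 -> 0 <= u <= 1 ->
  `|s `^ t * s - s `^ u * s| <= (a + 1) ^+ 4 * `|t - u|.
Proof.
wlog ut : t u / u <= t => [hw sa t01 u01|].
  have [ut|/ltW tu] := leP u t; first exact: hw.
  by rewrite distrC (distrC t); exact: hw.
move=> /andP[s0 sa] /andP[t0 t1] /andP[u0 u1].
have a1 : 1 <= a + 1 by rewrite lerDr (le_trans s0).
have C0 : 0 <= (a + 1) ^+ 4 by rewrite exprn_ge0// (le_trans _ a1).
have [->|sn0] := eqVneq s 0; first by rewrite !mulr0 subrr normr0 mulr_ge0.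
have {sn0}s0 : 0 < s by rewrite lt0r sn0.
rewrite [in leRHS]ger0_norm ?subr_ge0//; set h := t - u.
have h0 : 0 <= h by rewrite subr_ge0.
have h1 : h <= 1 by rewrite lerBlDr (le_trans t1)// lerDl.
have -> : s `^ t = s `^ u * s `^ h.
  by rewrite -powRD ?(gt_eqF s0) ?implybT// /h subrKC.
have -> : s `^ u * s `^ h * s - s `^ u * s = s `^ u * (s * (s `^ h - 1)) by ring.
rewrite normrM (ger0_norm (powR_ge0 _ _)) normrM (gtr0_norm s0).
have lns : 1 + h * ln s <= s `^ h.
  by rewrite /powR gt_eqF// expR_ge1Dx.
have lnsN : 1 - h * ln s <= (s `^ h)^-1.
  by rewrite -powRN /powR gt_eqF// mulNr expR_ge1Dx.
have [s1|/ltW s1] := leP s 1.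
  have su1 : s `^ u <= 1.
    by rewrite -(powRr0 s) ger_powR ?s0.
  have sh1 : s `^ h <= 1.
    by rewrite -(powRr0 s) ger_powR ?s0.
  rewrite ler0_norm ?subr_le0// opprB.
  apply: (@le_trans _ _ h); last by rewrite ler_peMl// exprn_ege1.
  apply: (@le_trans _ _ (s * (1 - s `^ h))).
    by rewrite ler_piMl// mulr_ge0 ?(ltW s0) ?subr_ge0.
  rewrite mulrC -ler_pdivlMr//.
  have := ln_sublinear (x := s^-1); rewrite invr_gt0 lnV ?posrE// => /(_ s0) lnV_lt.
  have := ler_wpM2l h0 (ltW lnV_lt); move: lns; lra.
have sa1 : s <= a + 1 by rewrite (le_trans sa)// lerDl.
have su1 : s `^ u <= s by exact: ler1_powR.
have sh1 : s `^ h <= s by exact: ler1_powR.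
have sh0 : 1 <= s `^ h by have := ler_powR s1 h0; rewrite powRr0.
have shp : 0 < s `^ h by rewrite powR_gt0.
rewrite ger0_norm ?subr_ge0//.
have key : s `^ h - 1 <= s * (h * s).
  have -> : s `^ h - 1 = s `^ h * (1 - (s `^ h)^-1) by field; rewrite gt_eqF.
  apply: ler_pM => //; rewrite ?powR_ge0//.
    by rewrite subr_ge0 invf_le1.
  have := ler_wpM2l h0 (ltW (ln_sublinear s0)); move: lnsN; lra.
apply: (@le_trans _ _ (s * (s * (s * (h * s))))).
  apply: ler_pM; rewrite ?powR_ge0 ?mulr_ge0 ?(ltW s0) ?subr_ge0//.
  by rewrite ler_wpM2l ?(ltW s0).
have -> : s * (s * (s * (h * s))) = s ^+ 4 * h by ring.
by rewrite ler_wpM2r// ler_pXn2r ?nnegrE ?(ltW s0)// (le_trans _ a1).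
Qed.

(** * Powers of |T| and their strong continuity *)

Section AbsolutePowers.
Local Open Scope complex_scope.
Variables (R : realType) (H : hilbertType R) (T : H -> H).
Hypothesis bT : bounded_operator T.
Implicit Types (x y z : H) (s t u e d : R).

Local Notation nr := (@realnorm R H).
Local Notation K := (kernel_proj (absop T)).

Let pQ := absop_positive bT.
Let bQ : bounded_operator (absop T). Proof. by case: pQ. Qed.
Let linQ : linear (absop T). Proof. exact: bounded_lin bQ. Qed.

Lemma abspow0 x : abspow T 0 x = x - K x.
Proof. by rewrite /abspow eqxx /= adjoint_polar. Qed.

Lemma abspow_cfc t : 0 < t <= 1 -> is_cfc (fun s => s `^ t) (absop T) (abspow T t).
Proof.
by move=> t01; case/andP: (t01) => t0 _; rewrite /abspow gt_eqF//; exact: oppowP.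
Qed.

Lemma powR_absop_le t s : 0 <= t -> 0 <= s <= opnorm (absop T) ->
  `|s `^ t| <= opnorm T `^ t.
Proof.
move=> t0 /andP[s0 sQ]; rewrite ger0_norm ?powR_ge0//.
apply: (ge0_ler_powR t0); rewrite ?nnegrE ?opnorm_ge0//.
by rewrite (le_trans sQ)// opnorm_absop.
Qed.

Lemma abspow_bounded_by t : 0 <= t <= 1 -> bounded_by (abspow T t) (opnorm T `^ t).
Proof.
move=> /andP[]; rewrite le_eqVlt => /orP[/eqP <- _ x|t0 t1].
  by rewrite powRr0 mul1r abspow0 nr_sub_kernel_proj.
apply: (cfc_bounded_by pQ (abspow_cfc _)); first by rewrite t0.
by move=> s; apply: powR_absop_le; exact: ltW.
Qed.

Lemma abspow_lin t : 0 <= t <= 1 -> linear (abspow T t).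
Proof.
move=> /andP[]; rewrite le_eqVlt => /orP[/eqP <- _ |t0 t1]; last first.
  by apply: (cfc_lin pQ (abspow_cfc (t := t) _)); rewrite t0.
move=> k x y; rewrite !abspow0 (kernel_proj_lin pQ) scalerBr.
by rewrite opprD addrACA.
Qed.

Lemma abspow_bounded t : 0 <= t <= 1 -> bounded_operator (abspow T t).
Proof.
by move=> t01; apply: bounded_byP (abspow_bounded_by t01); exact: abspow_lin.
Qed.

Lemma kernel_proj_absop x : K (absop T x) = 0.
Proof.
apply: nlim_uniq (kernel_projP pQ _) _.
have -> : (fun n => poly_op (damping (absop T) n) (absop T) (absop T x)) =
    absop T \o (fun n => poly_op (damping (absop T) n) (absop T) x).
  by apply/funext => n /=; rewrite !poly_opE cpoly_op_comm.
rewrite -(kernel_projK pQ x).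
exact: nlim_bounded linQ (opnorm_ub bQ) (kernel_projP pQ x).
Qed.

(** The endpoints are separate because s^0 is 1 even at s = 0: the calculus would give the identity
    where |T|^0 is the projection 1 - K. *)
Lemma abspow_comp t x : 0 <= t <= 1 ->
  abspow T (1 - t) (abspow T t x) = absop T x.
Proof.
move=> /andP[]; rewrite le_eqVlt => /orP[/eqP <- _|t0].
  have -> : abspow T (1 - 0) = absop T.
    apply: (cfc_eq pQ (abspow_cfc _) (cfc_id _)); first by rewrite subr0 ltr01 lexx.
    by move=> s /andP[s0 _]; rewrite subr0 powRr1.
  by rewrite abspow0 (linB _ _ linQ) (kernel_projK pQ) subr0.
rewrite le_eqVlt => /orP[/eqP ->|t1].
  have -> : abspow T 1 = absop T.
    apply: (cfc_eq pQ (abspow_cfc _) (cfc_id _)); first by rewrite ltr01 lexx.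
    by move=> s /andP[s0 _]; rewrite powRr1.
  by rewrite subrr abspow0 kernel_proj_absop subr0.
have t'0 : 0 < 1 - t by rewrite subr_gt0.
have c1 : is_cfc (fun s => s `^ (1 - t)) (absop T) (abspow T (1 - t)).
  by apply: abspow_cfc; rewrite t'0 gerBl ltW.
have c2 : is_cfc (fun s => s `^ t) (absop T) (abspow T t).
  by apply: abspow_cfc; rewrite t0 ltW.
have c3 := cfc_comp pQ c1 c2 (fun s => powR_absop_le (ltW t'0))
  (fun s => powR_absop_le (ltW t0)).
suff E : abspow T (1 - t) \o abspow T t = absop T by exact: (congr1 (@^~ x) E).
apply: (cfc_eq pQ c3 (cfc_id _)) => s /andP[s0 _].
by rewrite -powRD ?subrK ?oner_eq0// powRr1.
Qed.

(** After multiplication by |T| the exponent 0 is no longer exceptional, since K vanishes on the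
    range of |T|. *)
Lemma abspow_absop_cfc t : 0 <= t <= 1 ->
  is_cfc (fun s => s `^ t * s) (absop T) (abspow T t \o absop T).
Proof.
move=> /andP[]; rewrite le_eqVlt => /orP[/eqP <- _|t0 t1].
  have := cfc_id (absop T); congr is_cfc.
    by apply/funext => s; rewrite powRr0 mul1r.
  by apply/funext => x /=; rewrite abspow0 kernel_proj_absop subr0.
apply: (cfc_comp pQ (abspow_cfc _) (cfc_id _)); first by rewrite t0.
  by move=> s; apply: powR_absop_le; exact: ltW.
by move=> s /andP[s0]; rewrite ger0_norm//; apply.
Qed.

(** On a kernel vector p(|T|) acts as the scalar p(0), which is close to 0^t = 0 when t > 0. *)
Lemma abspow_eq0 t y : 0 <= t <= 1 -> absop T y = 0 -> abspow T t y = 0.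
Proof.
move=> /andP[]; rewrite le_eqVlt => /orP[/eqP <- _|t0 t1] Qy.
  by rewrite abspow0 (kernel_proj_fix pQ)// subrr.
apply/nr_eq0/le_anti; rewrite nr_ge0 andbT; apply: (@le_eps _ (2 * nr y)) => e e0.
have t01 : 0 < t <= 1 by rewrite t0.
have [p [pt pY]] := abspow_cfc t01 e0.
have {pt} := pt 0; rewrite lexx opnorm_ge0// powR0 ?gt_eqF// subr0 => /(_ isT) p0.
have := pY y; rewrite norm_leE => {}pY.
have py : poly_op p (absop T) y = p.[0]%:C *: y.
  elim/poly_ind: p {p0 pY} => [|p c IH].
    by rewrite horner0 -polyC0 poly_opC.
  by rewrite poly_opD poly_opMX poly_opC Qy !hornerE (lin0 (poly_op_lin p linQ)) ?mulr0 !add0r.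
have := nr_le (abspow T t y) (poly_op p (absop T) y).
rewrite nrC; have := ler_wpM2r (nr_ge0 y) p0; move: pY; rewrite py nrZr; lra.
Qed.

Lemma abspow_strong_continuous t x e : 0 <= t <= 1 -> 0 < e ->
  exists2 d, 0 < d & forall u, 0 <= u <= 1 -> `|u - t| <= d ->
    nr (abspow T u x - abspow T t x) <= e.
Proof.
(* [M] bounds all the powers at once: ||T||^u <= M^u <= M. *)
move=> t01 e0; pose M := opnorm T + 1.
have M1 : 1 <= M by rewrite lerDr opnorm_ge0.
have M0 : 0 < M by rewrite (lt_le_trans _ M1).
have YM u : 0 <= u <= 1 -> bounded_by (abspow T u) M.
  move=> u01; apply: bounded_by_le (abspow_bounded_by u01) _; case/andP: u01 => u0 u1.
  apply: (@le_trans _ _ (M `^ u)).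
    by apply: (ge0_ler_powR u0); rewrite ?nnegrE ?opnorm_ge0 ?(ltW M0)// lerDl.
  exact: ler1_powR.
(* Replacing x by |T| z costs e/4 at each of u and t after multiplication by M; the remaining e/2
   goes to the Lipschitz estimate [mid]. *)
have [n] := nlim_eps (kernel_proj_lim pQ x) (divr_gt0 e0 (mulr_gt0 (@ltr0n R 4) M0)).
set z := poly_op _ _ x => zx.
pose C := (opnorm (absop T) + 1) ^+ 4.
have C0 : 0 < C by rewrite exprn_gt0// ltr_wpDl// opnorm_ge0.
have z0 : 0 < nr z + 1 by rewrite ltr_wpDl// nr_ge0.
have Cz0 : 0 < 2 * C * (nr z + 1) by apply: mulr_gt0 => //; apply: mulr_gt0.
exists (e / (2 * C * (nr z + 1))); first exact: divr_gt0.
move=> u u01 ut.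
have Yx v : 0 <= v <= 1 -> abspow T v x = abspow T v (x - K x).
  move=> v01; rewrite (linB _ _ (abspow_lin v01)).
  by rewrite (abspow_eq0 v01 (kernel_projK pQ x)) subr0.
have near v : 0 <= v <= 1 ->
    nr (abspow T v (absop T z) - abspow T v x) <= e / 4.
  move=> v01; rewrite Yx// -(linB _ _ (abspow_lin v01)) (le_trans (YM _ v01 _))//.
  rewrite mulrC -ler_pdivlMr// (le_trans zx)//.
  by rewrite le_eqVlt; apply/orP; left; apply/eqP; field; rewrite gt_eqF.
have mid : nr (abspow T u (absop T z) - abspow T t (absop T z)) <= e / 2.
  apply: le_trans (cfc_dist pQ (abspow_absop_cfc u01) (abspow_absop_cfc t01) _ z) _.
    by move=> s sI; apply: powR_lipschitz => //; exact: sI.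
  rewrite -/C; apply: (@le_trans _ _ (C * `|u - t| * (nr z + 1))).
    by apply: ler_wpM2l; [apply: mulr_ge0 => //; exact: ltW|rewrite lerDl].
  move: ut; rewrite ler_pdivlMr//; lra.
have h1 := nrB (abspow T u x) (abspow T t x) (abspow T u (absop T z)).
have h2 := nrB (abspow T u (absop T z)) (abspow T t x) (abspow T t (absop T z)).
have h3 := near _ u01; have h4 := near _ t01.
rewrite nrC in h3; move: h1 h2 h3 h4 mid; do 5 move: (nr (_ - _)).
by move=> ? ? ? ? ?; lra.
Qed.

End AbsolutePowers.

(** * Numerical radius inequalities *)

Section NumericalRadius.
Local Open Scope complex_scope.
Variables (R : realType) (H : hilbertType R).
Implicit Types (x y z : H) (a b e w : R) (A B S T P : H -> H) (k : R[i]).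

Local Notation nr := (@realnorm R H).

Lemma rip_conj k x y : rip (k *: x) y = rip x (k^*%C *: y).
Proof. by rewrite /rip innerZl innerZr conjcK. Qed.

(* [2 Re<ABx, x> <= |pBx + q A^* x|^2 / 2] when [p q = 1], and the norm of the adjoint
   [p B^* + q A] involves [BA] instead of [AB]; [p] balances [p b] and [q a]. *)
Lemma rip_comp_le A B a b w : bounded_operator A -> bounded_operator B ->
  0 <= a -> 0 <= b -> bounded_by A a -> bounded_by B b ->
  (forall y, rip (B (A y)) y <= w * nr y ^+ 2) ->
  0 <= w -> forall x, 2 * rip (A (B x)) x <= (w + a * b) * nr x ^+ 2.
Proof.
move=> bA bB a0 b0 Aa Bb BAw w0 x.
(* The balancing p = sqrt(a/b) needs a and b positive; otherwise AB = 0. *)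
have [ab0|ab0] := eqVneq (a * b) 0.
  have -> : A (B x) = 0.
    apply/nr_eq0/le_anti; rewrite nr_ge0 andbT -(mul0r (nr x)) -ab0.
    exact: (bounded_by_comp a0 Aa Bb x).
  by rewrite rip0l mulr0 mulr_ge0 ?sqr_ge0// addr_ge0// mulr_ge0.
have {a0}a0 : 0 < a by rewrite lt0r a0 andbT; apply: contraNneq ab0 => ->; rewrite mul0r.
have {b0}b0 : 0 < b by rewrite lt0r b0 andbT; apply: contraNneq ab0 => ->; rewrite mulr0.
pose p := Num.sqrt (a / b).
have p0 : 0 < p by rewrite sqrtr_gt0 divr_gt0.
have pp : p ^+ 2 = a / b by rewrite sqr_sqrtr// divr_ge0 ?ltW.
pose E x := p%:C *: B x + p^-1%:C *: adjoint A x.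
pose F x := p%:C *: adjoint B x + p^-1%:C *: A x.
have EF y z : rip (E y) z = rip y (F z).
  rewrite /E /F ripDl ripDr !ripZl !ripZr adjoint_rip// adjoint_ripC//.
have m0 : 0 <= 2 * (w + a * b) by rewrite mulr_ge0// addr_ge0// mulr_ge0 ?ltW.
(* |Fy|^2 = (a/b) |B^* y|^2 + 2 Re <BAy, y> + (b/a) |Ay|^2 <= (ab + 2w + ab) |y|^2. *)
have FM : bounded_by F (Num.sqrt (2 * (w + a * b))).
  move=> y; rewrite -(@ler_pXn2r _ 2)// ?nnegrE ?mulr_ge0 ?nr_ge0 ?sqrtr_ge0//.
  rewrite exprMn sqr_sqrtr// nr_sqrD !nrZr ripZl ripZr !exprMn !real_normK ?num_real//.
  rewrite adjoint_ripC// [p * _]mulrA divff ?gt_eqF// mul1r exprVn pp.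
  have h1 : nr (adjoint B y) ^+ 2 <= b ^+ 2 * nr y ^+ 2.
    rewrite -exprMn ler_pXn2r ?nnegrE ?mulr_ge0 ?nr_ge0 ?(ltW b0)//.
    exact: adjoint_bounded_by (ltW b0) bB Bb y.
  have h2 : nr (A y) ^+ 2 <= a ^+ 2 * nr y ^+ 2.
    by rewrite -exprMn ler_pXn2r ?nnegrE ?mulr_ge0 ?nr_ge0 ?(ltW a0).
  have h3 : a / b * nr (adjoint B y) ^+ 2 <= a * b * nr y ^+ 2.
    have -> : a * b * nr y ^+ 2 = a / b * (b ^+ 2 * nr y ^+ 2) by field; rewrite gt_eqF.
    by apply: ler_wpM2l => //; rewrite divr_ge0 ?ltW.
  have h4 : (a / b)^-1 * nr (A y) ^+ 2 <= a * b * nr y ^+ 2.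
    have -> : a * b * nr y ^+ 2 = (a / b)^-1 * (a ^+ 2 * nr y ^+ 2).
      by field; rewrite !gt_eqF.
    by apply: ler_wpM2l => //; rewrite invr_ge0 divr_ge0 ?ltW.
  have h5 := BAw y; rewrite ripC.
  by move: h3 h4 h5; rewrite mulrDr mulrDl; move: (a / b * _) (_^-1 * _) => X Y; lra.
have := dual_bounded_by (sqrtr_ge0 _) EF FM x.
rewrite -(@ler_pXn2r _ 2)// ?nnegrE ?mulr_ge0 ?nr_ge0 ?sqrtr_ge0//.
rewrite exprMn sqr_sqrtr// => Em.
have -> : rip (A (B x)) x = rip (p%:C *: B x) (p^-1%:C *: adjoint A x).
  by rewrite ripZl ripZr mulrA divff ?gt_eqF// mul1r adjoint_rip.
have := sqr_ge0 (nr (p%:C *: B x - p^-1%:C *: adjoint A x)).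
rewrite nr_sqrB; move: Em; rewrite /E nr_sqrD.
move: (rip _ _) => r; lra.
Qed.


(** Separates the Aluthge transform from the fourth power estimate: w may be any bound of 2 w(T^2),
    so one proof serves every t. *)
Lemma numradius_pow4_le T P w : bounded_operator T ->
  P = (adjoint T \o T) \+ (T \o adjoint T) -> 0 <= w ->
  (forall x k, complex.Re `|k| = 1 -> 2 * rip (k *: T (T x)) x <= w * nr x ^+ 2) ->
  numradius T ^+ 4 <= 16^-1 * w ^+ 2 +
    (8^-1 * numradius ((T \o T \o P) \+ (P \o T \o T)) + 16^-1 * opnorm P ^+ 2).
Proof.
move=> bT PE w0 T2w; have linT := bounded_lin bT.
have bTs := adjoint_bounded bT; have linTs := bounded_lin bTs.
have bP : bounded_operator P by rewrite PE; apply: bounded_add; exact: bounded_comp.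
have symP x y : rip (P x) y = rip x (P y).
  rewrite PE /= ripDl ripDr; congr (_ + _).
    by rewrite adjoint_ripC// adjoint_rip.
  by rewrite adjoint_rip// adjoint_ripC.
set C := (_ \o P) \+ _.
have bC : bounded_operator C.
  apply: bounded_add; first exact: bounded_comp (bounded_comp bT bT) bP.
  exact: bounded_comp (bounded_comp bP bT) bT.
set Z := _ + (_ + _).
have Z0 : 0 <= Z.
  rewrite /Z; have := numradius_ge0 bC; have := sqr_ge0 w; have := sqr_ge0 (opnorm P).
  lra.
suff wZ : numradius T <= Num.sqrt (Num.sqrt Z).
  have -> : Z = Num.sqrt (Num.sqrt Z) ^+ 4.
    by rewrite (exprM _ 2 2) sqr_sqrtr ?sqrtr_ge0// sqr_sqrtr.
  by rewrite ler_pXn2r// ?nnegrE ?sqrtr_ge0 ?numradius_ge0.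
apply: numradius_le => [|x k x1 k1]; first exact: sqrtr_ge0.
rewrite (le_trans (ler_norm _))// -sqrtr_sqr ler_sqrt ?sqrtr_ge0//.
rewrite -[leLHS]ger0_norm ?sqr_ge0// -sqrtr_sqr ler_sqrt// -exprM.
set r := rip _ _.
have kk : k * k^*%C = 1.
  by rewrite -sqr_normc -[`|k|]RRe_real ?normr_real// k1 expr1n.
have k21 : complex.Re `|k ^+ 2| = 1.
  by rewrite normrX -[`|k|]RRe_real ?normr_real// k1 expr1n.
have kN21 : complex.Re `|- k ^+ 2| = 1 by rewrite normrN.
pose T1 y := k *: T y; pose T2 y := k^*%C *: adjoint T y.
have T12 y z : rip (T1 y) z = rip y (T2 z).
  by rewrite /T1 /T2 rip_conj adjoint_rip// linZ.
have T21 y z : rip (T2 y) z = rip y (T1 z) by rewrite ripC -T12 ripC.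
have T11 y : T1 (T1 y) = k ^+ 2 *: T (T y) by rewrite /T1 linZ// scalerA.
pose W y := T1 (T1 y) + T2 (T2 y).
have linW : linear W.
  apply: lin_add; apply: lin_comp; exact: lin_scale.
have symW y z : rip (W y) z = rip y (W z).
  by rewrite /W ripDl ripDr !T12 !T21 addrC.
have Ww y : `|rip (W y) y| <= w * nr y ^+ 2.
  have -> : rip (W y) y = 2 * rip (k ^+ 2 *: T (T y)) y.
    by rewrite /W ripDl !T21 T11 (ripC y); ring.
  (* -k^2 is a phase too, which gives the lower bound. *)
  rewrite ler_norml T2w// andbT lerNl -mulrN -ripNl -scaleNr.
  exact: T2w.
pose Q y := T1 y + T2 y.
have symQ y z : rip (Q y) z = rip y (Q z).
  by rewrite /Q ripDl ripDr T12 T21 addrC.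
have QQ : Q (Q x) = W x + P x.
  rewrite /Q /W PE /T1 /T2 /= (linD _ _ linT) (linD _ _ linTs) !(linZ _ _ linT) !(linZ _ _ linTs)
    !scalerDr !scalerA.
  rewrite [k^*%C * k]mulrC kk !scale1r.
  by rewrite addrACA [RHS]addrACA; congr (_ + _); exact: addrC.
have r4 : 16 * r ^+ (2 * 2) <= nr (Q (Q x)) ^+ 2.
  have -> : 16 * r ^+ (2 * 2) = ((2 * r) ^+ 2) ^+ 2 by ring.
  have -> : 2 * r = rip (Q x) x.
    by rewrite /Q ripDl T21 (ripC x) -/r; ring.
  rewrite ler_pXn2r ?nnegrE ?sqr_ge0 ?nr_ge0//.
  have h1 : rip (Q x) x ^+ 2 <= nr (Q x) ^+ 2.
    rewrite -real_normK ?num_real// ler_pXn2r ?nnegrE ?nr_ge0//.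
    by have := rip_norm_le (Q x) x; rewrite x1 mulr1.
  rewrite (le_trans h1)// -ripxx symQ (le_trans (rip_le _ _))// x1 mul1r//.
have WP : 2 * rip (W x) (P x) <= 2 * numradius C.
  rewrite ler_pM2l//.
  (* The adjoint half of W is moved to the other side and P is symmetric, so both halves end up with
     k^2 T^2. *)
  have -> : rip (W x) (P x) = rip (k ^+ 2 *: C x) x.
    rewrite /W ripDl !T21 !T11 -symP (ripC x) -ripDl.
    congr (rip _ x); rewrite /C /= scalerDr addrC; congr (_ + _).
    by apply: linZ; exact: bounded_lin.
  by have := numradius_ub x bC k21; rewrite x1 expr1n mulr1.
have Wx : nr (W x) ^+ 2 <= w ^+ 2.
  rewrite ler_pXn2r ?nnegrE ?nr_ge0//.
  by have := sym_norm_le w0 linW symW Ww x; rewrite x1 mulr1.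
have Px : nr (P x) ^+ 2 <= opnorm P ^+ 2.
  rewrite ler_pXn2r ?nnegrE ?nr_ge0 ?opnorm_ge0//.
  by have := opnorm_ub bP x; rewrite x1 mulr1.
move: r4; rewrite QQ nr_sqrD /Z; move: WP Wx Px; move: (r ^+ _) => r'.
move: (nr (W x) ^+ 2) (nr (P x) ^+ 2) (rip (W x) _) (numradius C) (opnorm P ^+ 2) (w ^+ 2).
by move=> ? ? ? ? ? ?; lra.
Qed.

End NumericalRadius.

(** * Minima of lower semicontinuous functions on the unit interval *)

Section AttainedMinimum.
Variable R : realType.
Implicit Types (t u e d : R) (f g h : R -> R).

Definition lsc_on_unit f := forall t e, 0 <= t <= 1 -> 0 < e ->
  exists2 d, 0 < d & forall u, 0 <= u <= 1 -> `|u - t| <= d -> f t <= f u + e.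

Lemma lsc_on_unit_comb g h (c : R) : 0 <= c -> lsc_on_unit g -> lsc_on_unit h ->
  lsc_on_unit (fun t => g t + c * h t).
Proof.
move=> c0 lscg lsch t e t01 e0; have c1 : 0 < c + 1 by rewrite ltr_wpDl.
have [d1 d10 h1] := lscg t _ t01 (divr_gt0 e0 (@ltr0n R 2)).
have [d2 d20 h2] := lsch t _ t01 (divr_gt0 e0 (mulr_gt0 (@ltr0n R 2) c1)).
exists (Num.min d1 d2) => [|u u01]; first by rewrite lt_min d10.
rewrite le_min => /andP[/(h1 _ u01) {}h1 /(h2 _ u01) {}h2].
have := ler_wpM2l c0 h2; rewrite mulrDr.
have : c * (e / (2 * (c + 1))) <= e / 2.
  have -> : e / (2 * (c + 1)) = (c + 1)^-1 * (e / 2) by field; rewrite gt_eqF.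
  by rewrite mulrA ler_piMl ?divr_ge0 ?(ltW e0)// ler_pdivrMr// mul1r lerDl.
by move: h1; lra.
Qed.

(** A minimising sequence clusters at some p in the compact interval; semicontinuity at p, at a
    nearby term of the sequence, gives f(p) <= inf + 2e. *)
Lemma lsc_on_unit_min f : lsc_on_unit f -> (forall t, 0 <= t <= 1 -> 0 <= f t) ->
  exists2 t, 0 <= t <= 1 & forall u, 0 <= u <= 1 -> f t <= f u.
Proof.
move=> lscf f0; pose E := [set f t | t in [set t | 0 <= t <= 1]].
have hasE : has_inf E.
  by split; [exists (f 0), 0 => //=; rewrite lexx ler01|exists 0 => _ [t t01 <-]; exact: f0].
have infE t : 0 <= t <= 1 -> inf E <= f t.
  by move=> t01; apply: ge_inf; [case: hasE|exists t].
have /choice[v vP] : forall n : nat, exists t, 0 <= t <= 1 /\ f t <= inf E + n.+1%:R^-1.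
  move=> n; have n0 : 0 < n.+1%:R^-1 :> R by rewrite invr_gt0 ltr0n.
  by have [_ [t t01 <-] tE] := inf_adherent n0 hasE; exists t; split=> //; exact: ltW.
have [p [p01 pv]] : [set` `[0, 1]%R] `&` cluster (v @ \oo) !=set0.
  apply: (@segment_compact R 0 1); exists 0%N => // n _ /=.
  by rewrite in_itv /=; case: (vP n).
have {}p01 : 0 <= p <= 1 by move: p01; rewrite /= in_itv.
exists p => // u u01; apply: le_trans (infE _ u01).
apply: (@le_eps _ 2) => e e0; have [d d0 dP] := lscf p e p01 e0.
have [N Ne] := inv_natS_le e0.
have vE : (v @ \oo) [set t | 0 <= t <= 1 /\ f t <= inf E + e].
  exists N => // n /= Nn; have [v01 vn] := vP n; split=> //.
  by rewrite (le_trans vn)// lerD2l Ne.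
have [t [[t01 te] tp]] := pv _ (ball p d) vE (nbhsx_ballx p d d0).
have := dP t t01; rewrite distrC => /(_ (ltW tp)); lra.
Qed.

End AttainedMinimum.

(** * The Aluthge transforms as functions of t *)

Section AluthgeTransform.
Variables (R : realType) (H : hilbertType R) (T : H -> H).
Hypothesis bT : bounded_operator T.
Implicit Types (x y z : H) (t u e d : R) (k : R[i]).

Local Notation nr := (@realnorm R H).
Local Notation S t := (aluthge_t t T).

Let unit_compl t : 0 <= t <= 1 -> 0 <= 1 - t <= 1.
Proof. by move=> /andP[t0 t1]; rewrite subr_ge0 t1 gerBl. Qed.

Lemma aluthge_bounded t : 0 <= t <= 1 -> bounded_operator (S t).
Proof.
move=> t01; apply: bounded_comp; last exact/(abspow_bounded bT)/unit_compl.
by apply: bounded_comp; [exact: abspow_bounded|exact: polar_bounded].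
Qed.

Lemma abspow_bounded_uniform t : 0 <= t <= 1 ->
  bounded_by (abspow T t) (opnorm T + 1).
Proof.
move=> t01; apply: bounded_by_le (abspow_bounded_by bT t01) _.
have M1 : 1 <= opnorm T + 1 by rewrite lerDr opnorm_ge0.
case/andP: t01 => t0 t1; apply: (@le_trans _ _ ((opnorm T + 1) `^ t)).
  apply: (ge0_ler_powR t0); rewrite ?nnegrE ?lerDl ?opnorm_ge0//.
  by rewrite (le_trans _ M1).
exact: ler1_powR.
Qed.

Lemma aluthge_bounded_uniform t : 0 <= t <= 1 ->
  bounded_by (S t) ((opnorm T + 1) * (opnorm T + 1)).
Proof.
move=> t01; have M0 : 0 <= opnorm T + 1 by rewrite addr_ge0 ?opnorm_ge0.
apply: bounded_by_comp => //; last exact/abspow_bounded_uniform/unit_compl.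
rewrite -[opnorm T + 1]mulr1; apply: bounded_by_comp => //.
  exact: abspow_bounded_uniform.
exact: polar_contraction.
Qed.

Definition strongly_continuous (F : R -> H) := forall t e, 0 <= t <= 1 -> 0 < e ->
  exists2 d, 0 < d & forall u, 0 <= u <= 1 -> `|u - t| <= d -> nr (F u - F t) <= e.

(** The uniform bound controls F_u (v_u - v_t); the rest, (F_u - F_t) v_t, is strong continuity at a
    fixed vector. *)
Lemma strongly_continuous_comp (F : R -> H -> H) (v : R -> H) (M : R) : 0 < M ->
  (forall t, 0 <= t <= 1 -> linear (F t) /\ bounded_by (F t) M) ->
  (forall x, strongly_continuous (F ^~ x)) -> strongly_continuous v ->
  strongly_continuous (fun t => F t (v t)).
Proof.
move=> M0 FM cF cv t e t01 e0.
have [d1 d10 h1] := cF (v t) _ _ t01 (divr_gt0 e0 (@ltr0n R 2)).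
have [d2 d20 h2] := cv _ _ t01 (divr_gt0 e0 (mulr_gt0 (@ltr0n R 2) M0)).
exists (Num.min d1 d2) => [|u u01]; first by rewrite lt_min d10.
rewrite le_min => /andP[/(h1 _ u01) {}h1 /(h2 _ u01) {}h2].
apply: le_trans (nrB _ _ (F u (v t))) _; rewrite [leRHS]splitr lerD//.
have [linF FuM] := FM _ u01; rewrite -(linB _ _ linF) (le_trans (FuM _))//.
rewrite mulrC -ler_pdivlMr// (le_trans h2)//.
by rewrite le_eqVlt; apply/orP; left; apply/eqP; field; rewrite gt_eqF.
Qed.

Lemma aluthge_strong_continuous x : strongly_continuous (fun t => S t x).
Proof.
have M0 : 0 < opnorm T + 1 by rewrite ltr_wpDl// opnorm_ge0.
apply: (strongly_continuous_comp (F := fun t y => abspow T t y) M0).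
- by move=> t t01; split; [exact: abspow_lin|exact: abspow_bounded_uniform].
- by move=> y t e t01 e0; exact: abspow_strong_continuous.
move=> t e t01 e0.
have [d d0 dP] := abspow_strong_continuous bT x (unit_compl t01) e0.
exists d => // u u01 ut; have linU := bounded_lin (polar_bounded bT).
rewrite /= -(linB _ _ linU) (le_trans (polar_contraction bT _))// mul1r.
by apply: dP; rewrite ?unit_compl// opprB addrC addrA subrK distrC.
Qed.

Lemma aluthge_sqr_strong_continuous x :
  strongly_continuous (fun t => S t (S t x)).
Proof.
have M0 : 0 < opnorm T + 1 by rewrite ltr_wpDl// opnorm_ge0.
apply: (strongly_continuous_comp (F := fun t y => S t y) (mulr_gt0 M0 M0)).
- move=> t t01; split; last exact: aluthge_bounded_uniform.
  exact: bounded_lin (aluthge_bounded t01).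
- by move=> y; exact: aluthge_strong_continuous.
exact: aluthge_strong_continuous.
Qed.

(** By contradiction: a unit vector x with |S_t x| > ||S_t|| - e/2 would give the neighbourhood by
    continuity at x, so none exists. The maximum with 0 covers the empty sphere, and a zero norm is
    trivially semicontinuous. *)
Lemma lsc_opnorm_aluthge : lsc_on_unit (fun t => opnorm (S t)).
Proof.
move=> t e t01 e0; apply: contrapT => hn.
suff : opnorm (S t) <= Num.max 0 (opnorm (S t) - e / 2).
  rewrite le_max => /orP[St|]; last by rewrite lerBrDr gerDl leNgt divr_gt0.
  apply: hn; exists 1 => // u u01 _; apply: le_trans St _.
  by rewrite addr_ge0 ?opnorm_ge0 ?(ltW e0)//; exact: aluthge_bounded.
apply: sup_le_ge0 => [|_ [x /norm1_nr x1 <-]]; first by rewrite le_max lexx.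
rewrite le_max; apply/orP; right; rewrite leNgt; apply/negP => hx; apply: hn.
have [d d0 dP] := aluthge_strong_continuous x t01 (divr_gt0 e0 (@ltr0n R 2)).
exists d => // u u01 ut.
have h1 := opnorm_ub (aluthge_bounded u01) x; rewrite x1 mulr1 in h1.
have h2 := nr_le (S t x) (S u x); rewrite nrC in h2.
have := dP u u01 ut; move: h1 h2 hx.
move: (opnorm _) (opnorm _) (nr (_ - _)) (nr _) (nr _) => ? ? ? ? ?; lra.
Qed.

Lemma lsc_numradius_aluthge : lsc_on_unit (fun t => numradius (S t \o S t)).
Proof.
have bSS t : 0 <= t <= 1 -> bounded_operator (S t \o S t).
  by move=> t01; apply: bounded_comp; exact: aluthge_bounded.
move=> t e t01 e0; apply: contrapT => hn.
suff : numradius (S t \o S t) <= Num.max 0 (numradius (S t \o S t) - e / 2).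
  rewrite le_max => /orP[St|]; last by rewrite lerBrDr gerDl leNgt divr_gt0.
  apply: hn; exists 1 => // u u01 _; apply: le_trans St _.
  by rewrite addr_ge0 ?numradius_ge0 ?(ltW e0)//; exact: bSS.
apply: numradius_le => [|x k x1 k1]; first by rewrite le_max lexx.
rewrite le_max; apply/orP; right; rewrite leNgt; apply/negP => hx; apply: hn.
have [d d0 dP] := aluthge_sqr_strong_continuous x t01 (divr_gt0 e0 (@ltr0n R 2)).
exists d => // u u01 ut.
have h1 := numradius_ub x (bSS _ u01) k1; rewrite x1 expr1n mulr1 in h1.
have h2 := rip_le (k *: (S t (S t x) - S u (S u x))) x.
rewrite nrZ k1 mul1r x1 mulr1 nrC scalerBr ripBl in h2.
have := dP u u01 ut; move: h1 h2 hx => /=.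
move: (numradius _) (numradius _) (nr (_ - _)) (rip _ _) (rip _ _) => ? ? ? ? ?; lra.
Qed.

(* [T = X Y] with [X = U |T|^(1-t)], [Y = |T|^t] and [S = Y X], so that [T^2 = (X S) Y]
   while [Y (X S) = S^2]. *)
Lemma rip_sqr_le t x k : 0 <= t <= 1 -> complex.Re `|k| = 1 ->
  2 * rip (k *: T (T x)) x <=
    (numradius (S t \o S t) + opnorm T * opnorm (S t)) * nr x ^+ 2.
Proof.
move=> t01 k1; have t'01 := unit_compl t01.
have bS := aluthge_bounded t01; have bSS := bounded_comp bS bS.
have bY := abspow_bounded bT t01; have bU := polar_bounded bT.
pose X := polar T \o abspow T (1 - t).
have bX : bounded_operator X by apply: bounded_comp; [|exact: abspow_bounded].
have linX := bounded_lin bX.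
have XY y : X (abspow T t y) = T y.
  by rewrite /X /= abspow_comp// polar_absop.
have [a0 b0] : 0 <= opnorm T `^ (1 - t) /\ 0 <= opnorm T `^ t by rewrite !powR_ge0.
have XM : bounded_by X (opnorm T `^ (1 - t)).
  rewrite -[_ `^ _]mul1r; apply: bounded_by_comp => //; first exact: polar_contraction.
  exact: abspow_bounded_by.
(* The phase goes into the second factor, so the reversed product is k S^2, controlled by
   [numradius_ub]. *)
have -> : k *: T (T x) = (X \o S t) (k *: abspow T t x).
  rewrite (linZ _ _ (bounded_lin (bounded_comp bX bS))) /=; congr (k *: _).
  by rewrite -(XY x) -(XY (X _)).
have -> : opnorm T * opnorm (S t) =
    opnorm T `^ (1 - t) * opnorm (S t) * opnorm T `^ t.
  by rewrite mulrAC -powRD ?subrK ?oner_eq0// powRr1 ?opnorm_ge0.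
apply: (rip_comp_le (A := X \o S t) (B := fun y => k *: abspow T t y)).
- exact: bounded_comp.
- exact: bounded_scale.
- by rewrite mulr_ge0// opnorm_ge0.
- by [].
- by apply: bounded_by_comp => //; exact: opnorm_ub.
- by rewrite -[_ `^ _]mul1r -k1; apply: bounded_by_scale; exact: abspow_bounded_by.
- by move=> y; exact: (numradius_ub y bSS k1).
- exact: numradius_ge0.
Qed.

End AluthgeTransform.

Theorem theorem2p15 (R : realType) (H : hilbertType R) (T : H -> H)
    (hT : bounded_operator T) :
  let P : H -> H := (adjoint T \o T) \+ (T \o adjoint T) in
  let rest : R :=
    8^-1 * numradius ((T \o T \o P) \+ (P \o T \o T))
    + 16^-1 * opnorm P ^+ 2 in
  let bound (S : H -> H) : R :=
    (numradius (S \o S) + opnorm T * opnorm S) ^+ 2 in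
  (exists2 m : R,
     is_minimum [set bound (aluthge_t t T) | t in [set t : R | 0 <= t <= 1]] m &
     numradius T ^+ 4 <= 16^-1 * m + rest)
  /\ numradius T ^+ 4 <= 16^-1 * bound (aluthge T) + rest.
Proof.
move=> P rest bound.
pose f (t : R) := numradius (aluthge_t t T \o aluthge_t t T) + opnorm T * opnorm (aluthge_t t T).
have f0 (t : R) : 0 <= t <= 1 -> 0 <= f t.
  move=> t01; have bS := aluthge_bounded hT t01.
  by rewrite addr_ge0 ?numradius_ge0 ?mulr_ge0 ?opnorm_ge0//; exact: bounded_comp.
have main (t : R) : 0 <= t <= 1 -> numradius T ^+ 4 <= 16^-1 * bound (aluthge_t t T) + rest.
  move=> t01; apply: (numradius_pow4_le hT erefl (f0 t t01)) => x k.
  exact: rip_sqr_le.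
have lscf : lsc_on_unit f.
  apply: lsc_on_unit_comb (opnorm_ge0 hT) _ _.
    exact: lsc_numradius_aluthge.
  exact: lsc_opnorm_aluthge.
have fE (t : R) : bound (aluthge_t t T) = f t ^+ 2 by [].
split; last by apply: main; apply/andP; split; lra.
(* f is minimised instead of its square; as f >= 0, a minimiser of f also minimises f^2. *)
have [p p01 pmin] := lsc_on_unit_min lscf f0.
exists (bound (aluthge_t p T)); last exact: main.
split; first by exists p.
move=> _ [t t01 <-]; rewrite !fE; move: (f0 _ p01) (f0 _ t01) (pmin _ t01).
by move: (f p) (f t) => a b a0 b0; rewrite ler_pXn2r.
Qed.
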